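(* Let $(\Omega,\mathcal{F},P)$ be a probability space and $d$ a positive integer. The following two assertions are equivalent: (A) For every nonempty, a.s. bounded, $\mathcal{T}_{\varepsilon,\lambda}$-closed and $L^0$-convex subset $G$ of $L^0(\mathcal{F},\mathbb{R}^d)$, every $\sigma$-stable $\mathcal{T}_{\varepsilon,\lambda}$-continuous mapping $f:G\to G$ has a fixed point. (B) For every set-valued function $U:\Omega\to 2^{\mathbb{R}^d}$ with a measurable graph such that $U(\omega)$ is a nonempty bounded closed convex subset of $\mathbb{R}^d$ for each $\omega\in\Omega$, every local and continuous-in-probability operator from $G_U$ to itself has a fixed point.
   Context: $L^0(\mathcal{F},\mathbb{R}^d)$ is the set of a.s.-equivalence classes of random vectors $\Omega\to\mathbb{R}^d$, a module over $L^0(\mathcal{F})$ (classes of real random variables, with the a.s. order; $L^0_+(\mathcal{F})$ denotes the elements $\ge0$). The $L^0$-norm is $\|x\|=\sqrt{\sum_{i=1}^dx_i^2}$. $\mathcal{T}_{\varepsilon,\lambda}$ is the topology of convergence in probability. $\tilde I_A$ is the class of the indicator of $A\in\mathcal{F}$. A subset $G$ is a.s. bounded if $\bigvee\{\|x\|:x\in G\}\in L^0_+(\mathcal{F})$ (supremum in the lattice of classes of extended real random variables); $L^0$-convex if $\lambda x+(1-\lambda)y\in G$ for $x,y\in G$, $\lambda\in L^0_+(\mathcal{F})$, $\lambda\le1$; $\sigma$-stable if $\sum_n\tilde I_{A_n}x_n\in G$ for every sequence $\{x_n\}$ in $G$ and every countable measurable partition $\{A_n\}$ of $\Omega$ (nonempty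 $\mathcal{T}_{\varepsilon,\lambda}$-closed $L^0$-convex subsets are automatically $\sigma$-stable). A mapping $f:G\to G$ on a $\sigma$-stable set is $\sigma$-stable if $f(\sum_n\tilde I_{A_n}x_n)=\sum_n\tilde I_{A_n}f(x_n)$ for all such data. $U$ has a measurable graph if $\{(\omega,x)\in\Omega\times\mathbb{R}^d:x\in U(\omega)\}\in\mathcal{F}\otimes Bor(\mathbb{R}^d)$. $G_U=\{x\in L^0(\mathcal{F},\mathbb{R}^d):x\text{ has a representative }x^0\text{ with }x^0(\omega)\in U(\omega)\text{ a.s.}\}$. A mapping $h$ on a subset $G$ is local if, for all $x,y\in G$ and $A\in\mathcal{F}$, $x=y$ a.s. on $A$ implies $h(x)=h(y)$ a.s. on $A$; it is continuous in probability if it is continuous for the topologies of convergence in probability. *)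

(* Defs.v *)
From HB Require Import structures.
From mathcomp Require Import all_boot all_order all_algebra.
From mathcomp Require Import all_classical all_reals all_analysis.
From mathcomp Require Import measurable_realfun.
From mathcomp Require Import ring lra.

Set Implicit Arguments.
Unset Strict Implicit.
Unset Printing Implicit Defensive.

Import Order.TTheory GRing.Theory Num.Theory.
Import numFieldNormedType.Exports.

Local Open Scope classical_set_scope.
Local Open Scope ring_scope.
Local Open Scope quotient_scope.

(* R^n with its Borel sigma-algebra; as a plain type it is ['rV[R]_n] itself. *)
Notation borelRV R n := (g_sigma_algebraType (@open 'rV[R]_n)).

Section BorelRV.
Context {R : realType} {n : nat}.

Lemma measurable_rV_coord (i : 'I_n) :
  measurable_fun [set: borelRV R n]
    (fun v : borelRV R n => (v : 'rV[R]_n) 0 i : R).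
Proof.
apply: (measurability _ (RGenOpens.measurableE R)).
move=> _ [_ [a [b ->] <-]]; rewrite setTI; apply: sub_sigma_algebra.
have /continuousP := @coord_continuous R 1 n 0 i.
by apply; exact: interval_open.
Qed.

Context {d : measure_display} {T : measurableType d}.

Lemma measurable_fun_coord (f : T -> borelRV R n) (i : 'I_n) :
  measurable_fun [set: T] f ->
  measurable_fun [set: T] (fun t => (f t : 'rV[R]_n) 0 i : R).
Proof. by move=> mf; exact: (measurableT_comp (measurable_rV_coord i) mf). Qed.

Lemma measurable_fun_rV (f : T -> borelRV R n) :
  (forall i, measurable_fun [set: T] (fun t => (f t : 'rV[R]_n) 0 i : R)) ->
  measurable_fun [set: T] f.
Proof.
move=> mf; apply: (@measurability _ _ T (borelRV R n) setT f (@open _)) => //.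
move=> _ [V oV <-]; rewrite setTI.
pose q (p : 'rV[rat]_n * nat) : 'rV[R]_n := map_mx ratr p.1.
pose B (p : 'rV[rat]_n * nat) : set 'rV[R]_n := ball (q p) (p.2.+1%:R^-1).
have -> : f @^-1` V =
    \bigcup_(p : 'rV[rat]_n * nat)
      (if `[< B p `<=` V >] then f @^-1` B p else set0).
  apply/seteqP; split => [t /= Vt|t /= [p _]]; last first.
    by case: asboolP => // BV /BV.
  have /nbhs_ballP[e /= e0 eV] : nbhs (f t : 'rV[R]_n) V.
    exact: open_nbhs_nbhs.
  pose k := Num.truncn (2 / e).
  have ke : k.+1%:R^-1 < e / 2 :> R.
    rewrite -[ltRHS]invf_div ltf_pV2 ?posrE ?divr_gt0//.
    exact: truncnS_gt.
  have /choice[r rP] : forall i : 'I_n, exists r : rat,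
      ratr r \in `]((f t : 'rV[R]_n) 0 i - k.+1%:R^-1),
                    ((f t : 'rV[R]_n) 0 i + k.+1%:R^-1)[.
    move=> i; apply: rat_in_itvoo.
    have : 0 < k.+1%:R^-1 :> R by rewrite invr_gt0.
    by move: (k.+1%:R^-1) => z; lra.
  exists (\row_i r i, k) => //.
  have qt : forall i,
      `|q (\row_i r i, k) 0 i - (f t : 'rV[R]_n) 0 i| < k.+1%:R^-1.
    move=> i; rewrite !mxE; have := rP i; rewrite in_itv/= => /andP[r1 r2].
    rewrite ltr_norml; apply/andP.
    by split; move: r1 r2; move: (k.+1%:R^-1) => z; lra.
  case: asboolP => [_|[]].
    by split=> [|i j]; rewrite ?invr_gt0// ord1; exact: qt.
  move=> y qy; apply: eV; split=> // i j; rewrite ord1.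
  have := qy.2 0 j; have := qt j; rewrite /ball /=.
  set a := q _ 0 j; set b := (f t : 'rV[R]_n) 0 j; set c := y 0 j.
  move=> ab ac; rewrite (_ : b - c = (a - c) - (a - b)); last by ring.
  apply: le_lt_trans (ler_normB _ _) _.
  by move: ke ab ac; move: (k.+1%:R^-1) => z ? ? ?; lra.
apply: countable_bigcupT_measurable => // p; case: ifPn => // _.
have -> : f @^-1` B p = \bigcap_(i in [set: 'I_n])
    [set t | `|q p 0 i - (f t : 'rV[R]_n) 0 i| < p.2.+1%:R^-1].
  apply/seteqP; split => t /=.
    by move=> Bt i _; exact: (Bt.2 0 i).
  by move=> Bt; split=> [|i j]; rewrite ?invr_gt0// ord1; exact: (Bt j).
apply: fin_bigcap_measurable => [|i _]; first exact: finite_finset.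
have mg : measurable_fun [set: T]
    (fun t => `|q p 0 i - (f t : 'rV[R]_n) 0 i|).
  apply: measurableT_comp => //; apply: measurable_funB => //; exact: mf.
rewrite -[X in measurable X]setTI.
rewrite [X in _ `&` X](_ : _ =
    (fun t => `|q p 0 i - (f t : 'rV[R]_n) 0 i|) @^-1`
      `]-oo, (p.2.+1%:R^-1)[); last first.
  by apply/seteqP; split => t /=; rewrite in_itv.
exact: mg.
Qed.

End BorelRV.

(* Some members may be empty, so that finite partitions are included. *)
Record mpartition (d : measure_display) (T : measurableType d) := MPartition {
  mpart :> nat -> set T ;
  mpart_measurable : forall k, measurable (mpart k) ;
  mpart_trivIset : trivIset setT mpart ;
  mpart_cover : \bigcup_k mpart k = setT }.

Section L0.
Context {d : measure_display} {T : measurableType d} {R : realType}.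
Variable P : probability T R.

Section Classes.
Context {d' : measure_display} {Y : measurableType d'}.

Definition L0class (f : T -> Y) (mf : measurable_fun [set: T] f) :
    {mfun_ P, T >-> Y} :=
  \pi_({mfun_ P, T >-> Y}) (mfun_Sub (mem_set mf)).

Lemma L0classE (f : T -> Y) (mf : measurable_fun [set: T] f) :
  (L0class mf : T -> Y) = f %[ae P].
Proof.
have /eqP := reprK (L0class mf); rewrite {2}/L0class eqmodE => /asboolP.
by [].
Qed.

Lemma L0_eqP (x y : {mfun_ P, T >-> Y}) :
  x = y <-> (x : T -> Y) = y %[ae P].
Proof.
split => [->|xy]; first exact: ae_eq_refl.
by rewrite -[x]reprK -[y]reprK; apply/eqP; rewrite eqmodE; exact/asboolP.
Qed.

Lemma measurable_repr (x : {mfun_ P, T >-> Y}) :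
  measurable_fun [set: T] (x : T -> Y).
Proof. exact: measurable_funPT. Qed.

End Classes.

Definition ae_le {disp : Order.disp_t} {Y : porderType disp} (f g : T -> Y) :=
  {ae P, forall t, (f t <= g t)%O}.

(* The real-valued classes, and the classes of extended real random variables
   in which suprema are taken. *)
Definition L0R : Type := {mfun_ P, T >-> R}.
Definition L0bar : Type := {mfun_ P, T >-> \bar R}.

Definition L0fun (r : L0R) : T -> R := (r : {mfun_ P, T >-> R}).
Definition L0barfun (r : L0bar) : T -> \bar R := (r : {mfun_ P, T >-> \bar R}).

Definition L0le (r s : L0R) := ae_le (L0fun r) (L0fun s).

Definition L0cst (c : R) : L0R := L0class (@measurable_cst _ _ T R setT c).

Definition L0plus : set L0R := [set r | L0le (L0cst 0) r].

Definition L0sub (r s : L0R) : L0R :=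
  L0class (measurable_funB (measurable_repr r) (measurable_repr s)).

Definition L0R_bar (r : L0R) : L0bar :=
  L0class (measurableT_comp (@EFin_measurable R setT) (measurable_repr r)).

(* s is the least upper bound of S in the lattice of classes of extended real
   random variables. *)
Definition is_L0sup (S : set L0bar) (s : L0bar) :=
  (forall u, S u -> ae_le (L0barfun u) (L0barfun s)) /\
  (forall v, (forall u, S u -> ae_le (L0barfun u) (L0barfun v)) ->
     ae_le (L0barfun s) (L0barfun v)).

End L0.

Section RandomVectors.
Context {d : measure_display} {T : measurableType d} {R : realType}.
Variables (P : probability T R) (n : nat).

Definition L0V : Type := {mfun_ P, T >-> borelRV R n}.
HB.instance Definition _ := Choice.on L0V.

Definition vfun (x : L0V) : T -> 'rV[R]_n := (x : {mfun_ P, T >-> borelRV R n}).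

Lemma measurable_vfun (x : L0V) :
  measurable_fun [set: T] (vfun x : T -> borelRV R n).
Proof. exact: measurable_funPT. Qed.

Lemma measurable_vfun_coord (x : L0V) (i : 'I_n) :
  measurable_fun [set: T] (fun t => vfun x t 0 i).
Proof. exact: measurable_fun_coord (measurable_vfun x). Qed.

Fact measurable_add (x y : L0V) :
  measurable_fun [set: T] (fun t => vfun x t + vfun y t : borelRV R n).
Proof.
apply: measurable_fun_rV => i.
rewrite (_ : (fun t => _) =
      (fun t => vfun x t 0 i) \+ (fun t => vfun y t 0 i)).
  by apply: measurable_funD; exact: measurable_vfun_coord.
by apply/funext => t; rewrite !mxE.
Qed.

Definition L0add (x y : L0V) : L0V := L0class P (measurable_add x y).

Fact measurable_scale (r : L0R P) (x : L0V) :
  measurable_fun [set: T] (fun t => L0fun r t *: vfun x t : borelRV R n).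
Proof.
apply: measurable_fun_rV => i.
rewrite (_ : (fun t => _) = L0fun r \* (fun t => vfun x t 0 i)).
  apply: measurable_funM; [exact: measurable_repr|exact: measurable_vfun_coord].
by apply/funext => t; rewrite !mxE.
Qed.

Definition L0scale (r : L0R P) (x : L0V) : L0V :=
  L0class P (measurable_scale r x).

(* The library norm of ['rV[R]_n] is the maximum norm. *)
Definition enorm (v : 'rV[R]_n) : R := Num.sqrt (\sum_i v 0 i ^+ 2).

Lemma measurable_enorm (f : T -> 'rV[R]_n) :
  (forall i, measurable_fun [set: T] (fun t => f t 0 i)) ->
  measurable_fun [set: T] (fun t => enorm (f t)).
Proof.
move=> mf; apply: (measurableT_comp (f := @Num.sqrt R)).
  by apply: continuous_measurable_fun; exact: sqrt_continuous.
by apply: measurable_sum => i; exact: measurable_funX.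
Qed.

Definition L0norm (x : L0V) : L0R P :=
  L0class P (measurable_enorm (measurable_vfun_coord x)).

Definition concat_fun (A : mpartition T) (x : nat -> L0V) (t : T) : 'rV[R]_n :=
  limn (series (fun k => \1_(A k) t *: vfun (x k) t)).

Lemma concat_funE (A : mpartition T) (x : nat -> L0V) (m : nat) (t : T) :
  A m t -> concat_fun A x t = vfun (x m) t.
Proof.
move=> Amt; apply: lim_near_cst => //.
exists m.+1 => // k /= mk; rewrite /series /=.
rewrite (bigD1_seq m)/= ?iota_uniq//; last first.
  by rewrite mem_index_iota.
rewrite indicE mem_set// scale1r big1 ?addr0// => j jm.
rewrite indicE memNset ?scale0r// => Ajt; move/eqP : jm; apply.
have /trivIsetP := @mpart_trivIset _ _ A; apply: contraPP => jm /(_ j m I I).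
by move/(_ (introN eqP jm)); apply/eqP/set0P; exists t.
Qed.

Fact measurable_concat (A : mpartition T) (x : nat -> L0V) :
  measurable_fun [set: T] (concat_fun A x : T -> borelRV R n).
Proof.
rewrite -(mpart_cover A); apply/measurable_fun_bigcup.
  exact: mpart_measurable.
move=> k; apply: (eq_measurable_fun (vfun (x k) : T -> borelRV R n)).
  by move=> t /set_mem Akt; rewrite (concat_funE _ Akt).
by apply: measurable_funTS; exact: measurable_vfun.
Qed.

Definition concat (A : mpartition T) (x : nat -> L0V) : L0V :=
  L0class P (measurable_concat A x).

Definition far (e : R) (x y : L0V) : set T :=
  [set t | e <= enorm (vfun x t - vfun y t)].

Lemma measurable_far (e : R) (x y : L0V) : measurable (far e x y).
Proof.
have mg : measurable_fun [set: T] (fun t => enorm (vfun x t - vfun y t)).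
  apply: measurable_enorm => i.
  rewrite (_ : (fun t => _) =
      (fun t => vfun x t 0 i) \- (fun t => vfun y t 0 i)).
    by apply: measurable_funB; exact: measurable_vfun_coord.
  by apply/funext => t; rewrite !mxE.
rewrite -[X in measurable X]setTI.
rewrite [X in _ `&` X](_ : _ =
    (fun t => enorm (vfun x t - vfun y t)) @^-1` `[e, +oo[); last first.
  by apply/seteqP; split => t /=; rewrite in_itv/= andbT.
exact: mg.
Qed.

(* The uniformity of convergence in probability. *)
Definition prob_ent : set_system (L0V * L0V) :=
  filter_from [set el : R * R | 0 < el.1 /\ 0 < el.2]
    (fun el => [set xy | (P (far el.1 xy.1 xy.2) < el.2%:E)%E]).

Lemma far_le (e1 e2 : R) (x y : L0V) : e1 <= e2 -> far e2 x y `<=` far e1 x y.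
Proof. by move=> e12 t; exact: le_trans. Qed.

Lemma P_far_le (e1 e2 : R) (x y : L0V) :
  e1 <= e2 -> (P (far e2 x y) <= P (far e1 x y))%E.
Proof.
move=> e12; apply: le_measure; rewrite ?inE; [exact: measurable_far..|].
exact: far_le.
Qed.

Fact prob_ent_filter : Filter prob_ent.
Proof.
apply: filter_from_filter; first by exists (1, 1) => /=.
move=> [e1 l1] [e2 l2] /= [e10 l10] [e20 l20].
exists (Num.min e1 e2, Num.min l1 l2) => /=.
  by rewrite !lt_min e10 e20 l10 l20.
move=> [x y] /= xy; split.
- apply: le_lt_trans (P_far_le x y _) (lt_le_trans xy _).
    by rewrite ge_min lexx.
  by rewrite lee_fin ge_min lexx.
- apply: le_lt_trans (P_far_le x y _) (lt_le_trans xy _).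
    by rewrite ge_min lexx orbT.
  by rewrite lee_fin ge_min lexx orbT.
Qed.

Fact prob_ent_diagonal A : prob_ent A -> diagonal `<=` A.
Proof.
move=> [[e l] /= [e0 l0] lA] [x y]; rewrite /diagonal /= => <-; apply: lA => /=.
rewrite (_ : far e x x = set0) ?measure0 ?lte_fin//.
apply/seteqP; split => t //=; rewrite /far /= subrr /enorm big1.
  by rewrite sqrtr0 leNgt e0.
by move=> i _; rewrite mxE expr0n.
Qed.

Fact prob_ent_inv A : prob_ent A -> prob_ent (A^-1)%relation.
Proof.
move=> [[e l] /= el lA]; exists (e, l) => // -[x y] /= xy; apply: lA => /=.
rewrite (_ : far e y x = far e x y)//; apply/seteqP; split => t;
  rewrite /far /=; congr (is_true (_ <= _)); congr Num.sqrt;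
  apply: eq_bigr => i _; by rewrite !mxE -sqrrN opprB.
Qed.

Lemma far_split (e : R) (x y z : L0V) : 0 < e ->
  far e x z `<=` far (e / 2) x y `|` far (e / 2) y z.
Proof.
move=> e0 t; rewrite /far /= => exz.
case: (leP (e / 2) (enorm (vfun x t - vfun y t))) => [|xy]; first by left.
right; rewrite leNgt; apply/negP => yz.
have sq v : enorm v < e / 2 -> \sum_i v 0 i ^+ 2 < e ^+ 2 / 4.
  rewrite /enorm => ve.
  have s0 : 0 <= \sum_i v 0 i ^+ 2 by apply: sumr_ge0 => i _; exact: sqr_ge0.
  rewrite -(sqr_sqrtr s0).
  move: (sqrtr_ge0 (\sum_i v 0 i ^+ 2)) ve; move: (Num.sqrt _) => a a0 ae.
  by nra.
move: exz; apply/negP; rewrite -ltNge /enorm.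
rewrite -[ltRHS](ger0_norm (ltW e0)) -sqrtr_sqr ltr_sqrt ?exprn_gt0//.
have h : \sum_i (vfun x t - vfun z t) 0 i ^+ 2 <=
    2 * (\sum_i (vfun x t - vfun y t) 0 i ^+ 2) +
    2 * (\sum_i (vfun y t - vfun z t) 0 i ^+ 2).
  rewrite !mulr_sumr -big_split/=; apply: ler_sum => i _; rewrite !mxE.
  move: (vfun x t 0 i) (vfun y t 0 i) (vfun z t 0 i) => a b c.
  rewrite -subr_ge0 (_ : _ - _ = (a - b - (b - c)) ^+ 2) ?sqr_ge0//; ring.
by move: h (sq _ xy) (sq _ yz) => ? ? ?; lra.
Qed.

Fact prob_ent_split A : prob_ent A ->
  exists2 B, prob_ent B & (B \; B `<=` A)%relation.
Proof.
move=> [[e l] /= [e0 l0] lA].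
exists [set xy | (P (far (e / 2) xy.1 xy.2) < (l / 2)%:E)%E].
  by exists (e / 2, l / 2) => //=; rewrite !divr_gt0.
move=> [x z] /= [y /= xy yz]; apply: lA => /=.
apply: (@le_lt_trans _ _ (P (far (e / 2) x y `|` far (e / 2) y z))).
  apply: le_measure; rewrite ?inE.
  - exact: measurable_far.
  - by apply: measurableU; exact: measurable_far.
  - exact: far_split.
apply: le_lt_trans (measureU2 _ _ _) _; [exact: measurable_far..|].
by rewrite [l]splitr EFinD lteD.
Qed.

HB.instance Definition _ := @isUniform.Build L0V prob_ent
  prob_ent_filter prob_ent_diagonal prob_ent_inv prob_ent_split.

Definition as_bounded (G : set L0V) :=
  exists2 r : L0R P, L0plus r &
    is_L0sup [set L0R_bar (L0norm x) | x in G] (L0R_bar r).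

Definition L0convex (G : set L0V) :=
  forall (x y : L0V) (l : L0R P), G x -> G y ->
    L0plus l -> L0le l (L0cst P 1) ->
    G (L0add (L0scale l x) (L0scale (L0sub (L0cst P 1) l) y)).

(* Nonempty closed L0-convex sets are automatically closed under [concat], which
   is what makes [f (concat A x)] a value of f on G. *)
Definition sigma_stable_map (G : set L0V) (f : L0V -> L0V) :=
  forall (A : mpartition T) (x : nat -> L0V),
    (forall k, G (x k)) -> f (concat A x) = concat A (f \o x).

Definition measurable_graph (U : T -> set 'rV[R]_n) :=
  measurable [set tv : T * borelRV R n | U tv.1 tv.2].

Definition selections (U : T -> set 'rV[R]_n) : set L0V :=
  [set x | exists2 x0 : {mfun T >-> borelRV R n},
    \pi_({mfun_ P, T >-> borelRV R n}) x0 = x & {ae P, forall t, U t (x0 t)}].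

Definition local_map (G : set L0V) (h : L0V -> L0V) :=
  forall (x y : L0V) (A : set T), G x -> G y -> measurable A ->
    vfun x = vfun y %[ae P in A] -> vfun (h x) = vfun (h y) %[ae P in A].

End RandomVectors.
Arguments selections {d T R} P {n} U.

(* Main.v *)
(** (A) => (B): the a.s. selections of U form a closed, L0-convex, a.s. bounded
    set, and a local map commutes with countable concatenations. The delicate
    point is that this set is nonempty, i.e. that a measurable graph has an
    a.s. measurable selection. Measurable subsets of T * R^n are Souslin over
    rectangles "measurable times compact"; by Choquet's capacitability argument
    the graph contains, up to small outer measure of the projection, a random
    compact set, from which a measurable point is picked by minimising the
    coordinates one after the other.

    (B) => (A): a closed L0-convex set G is stable under concatenation, so for
    each rational point q the essential infimum over G of the distance to q is
    approached along a sequence. All these sequences together form a sequence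
    in G that is a.s. pointwise dense in G, and G consists of the selections of
    the closure of its values. *)
Require Import Defs.
From mathcomp Require Import all_boot all_order all_algebra.
From mathcomp Require Import all_classical all_reals all_analysis.
From mathcomp Require Import measurable_realfun.
From mathcomp Require Import ring lra.

Set Implicit Arguments.
Unset Strict Implicit.
Unset Printing Implicit Defensive.

Import Order.TTheory GRing.Theory Num.Theory.
Import numFieldNormedType.Exports.

Local Open Scope classical_set_scope.
Local Open Scope ring_scope.

(** * Souslin sets *)

Section Baire.
Implicit Types (s p q : nat -> nat) (k m : nat).

Definition agree k p q := forall i, (i < k)%N -> p i = q i.

Definition upd p k m : nat -> nat := fun i => if i == k then m else p i.

Definition pointwise_le p q := forall i, (p i <= q i)%N.

Lemma agree_sym k p q : agree k p q -> agree k q p.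
Proof. by move=> pq i /pq. Qed.

Lemma agree_trans k p q s : agree k p q -> agree k q s -> agree k p s.
Proof. by move=> pq qs i ik; rewrite pq ?qs. Qed.

Lemma agree_le k m p q : (k <= m)%N -> agree m p q -> agree k p q.
Proof. by move=> km pq i ik; apply: pq; exact: leq_trans km. Qed.

(** Dependent choice along prefixes: [Good k] sees only the first [k] coordinates, so choosing
    coordinate [k] at stage [k] spoils no earlier stage. Both [fan] and [suslin_capacity] are run on
    it. *)
Lemma prefix_choice (Good : nat -> (nat -> nat) -> Prop) p0 :
  (forall k p q, agree k p q -> Good k p -> Good k q) ->
  Good 0%N p0 ->
  (forall k p, Good k p -> exists m, Good k.+1 (upd p k m)) ->
  exists p, forall k, Good k p.
Proof.
move=> Gagree G0 GS.
have /choice[F FP] : forall kp : nat * (nat -> nat), exists m,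
    Good kp.1 kp.2 -> Good kp.1.+1 (upd kp.2 kp.1 m).
  move=> [k p]; have [/GS[m Gm]|nG] := pselect (Good k p); first by exists m.
  by exists 0%N.
pose fix pk k := if k is j.+1 then upd (pk j) j (F (j, pk j)) else p0.
have GP k : Good k (pk k) by elim: k => //= k IH; exact: (FP (k, pk k)).
have pkS k j : (k <= j)%N -> agree k (pk j) (pk k).
  elim: j => [|j IH]; first by rewrite leqn0 => /eqP ->.
  rewrite leq_eqVlt => /predU1P[->//|kj] i ik /=.
  rewrite /upd ifF ?IH//; apply/negbTE.
  by rewrite neq_ltn (leq_trans ik)//.
(* Coordinate [i] is settled at stage [i.+1], so the diagonal agrees with [pk k] below [k]. *)
exists (fun i => pk i.+1 i) => k; apply: Gagree (GP k) => i ik.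
by rewrite (pkS i.+1 k).
Qed.

(* Koenig's lemma for the compact subset of Baire space bounded by [s]. *)
Lemma fan s (Q : (nat -> nat) -> nat -> Prop) :
  (forall p, pointwise_le p s ->
     exists k, forall q, pointwise_le q s -> agree k p q -> Q q k) ->
  (forall p k m, (k <= m)%N -> Q p k -> Q p m) ->
  exists k, forall p, pointwise_le p s -> Q p k.
Proof.
move=> Qloc Qmono; apply: contrapT => nQ.
(* A prefix is kept when no single bound serves all its extensions under [s]. If each extension by a
   value [m <= s k] had a bound, the maximum of these finitely many bounds would serve the prefix
   itself. *)
pose Good k p := (forall i, (i < k)%N -> (p i <= s i)%N) /\
  ~ exists N, forall q, pointwise_le q s -> agree k p q -> Q q N.
have [||k p [ps bad]|p Gp] := @prefix_choice Good s.
- move=> k p q pq [ps bad]; split=> [i ik|]; first by rewrite -pq ?ps.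
  apply: contra_not bad => -[N NP]; exists N => r rs pr; apply: NP => //.
  exact: agree_trans (agree_sym pq) pr.
- split=> // -[N NP]; apply: nQ; exists N => p ps; exact: NP.
- apply: contrapT => nG.
  have /choice[N NP] : forall m, exists N, (m <= s k)%N -> forall q,
      pointwise_le q s -> agree k.+1 (upd p k m) q -> Q q N.
    move=> m; apply: contrapT => nN; apply: nG; exists m; split => [i|].
      rewrite ltnS leq_eqVlt /upd => /predU1P[->|ik].
        rewrite eqxx leqNgt; apply/negP => ms; apply: nN; exists 0%N.
        by rewrite leqNgt ms.
      by rewrite ifF ?ps//; apply/negbTE; rewrite neq_ltn ik.
    by apply: contra_not nN => -[N NP]; exists N => _.
  apply: bad; exists (\max_(m < (s k).+1) N m)%N => q qs pq.
  have qk : (q k < (s k).+1)%N by rewrite ltnS qs.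
  apply: Qmono (NP (q k) (qs k) q qs _).
    exact: (leq_bigmax (Ordinal qk)).
  move=> i; rewrite ltnS leq_eqVlt /upd => /predU1P[->|ik]; first by rewrite eqxx.
  by rewrite ifF ?pq//; apply/negbTE; rewrite neq_ltn ik.
- have ps : pointwise_le p s by move=> i; exact: (Gp i.+1).1.
  have [k kP] := Qloc p ps.
  by apply: (Gp k).2; exists k.
Qed.

End Baire.

Section Suslin.
Context {d : measure_display} {T : measurableType d} {R : realType} {n : nat}.
Local Notation Y := 'rV[R]_n.

Definition locally_constant {X : Type} (E : nat -> (nat -> nat) -> X) :=
  forall m p, exists N, forall q, agree N p q -> E m q = E m p.

Definition scheme_set (E : nat -> (nat -> nat) -> set T * set Y) : set (T * Y) :=
  [set x | exists p, forall m, (E m p).1 x.1 /\ (E m p).2 x.2].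

(* Each [E m p] depends on finitely many coordinates of [p], so [scheme_set E] is
   the outcome of the Souslin operation on rectangles with a compact side. *)
Definition suslin_scheme (E : nat -> (nat -> nat) -> set T * set Y) :=
  [/\ forall m p, measurable (E m p).1, forall m p, compact (E m p).2 &
      locally_constant E].

Definition suslin (H : set (T * Y)) :=
  exists2 E, suslin_scheme E & H = scheme_set E.

Lemma suslin_rect (A : set T) (K : set Y) :
  measurable A -> compact K -> suslin (A `*` K).
Proof.
move=> mA cK; exists (fun _ _ => (A, K)).
  by split=> // m p; exists 0%N.
apply/seteqP; split=> [x [Ax Kx]|x [p /(_ 0%N)]//].
by exists (fun=> 0%N).
Qed.

(** The first coordinate of the index names the set; the remaining ones, shifted, index its
    scheme. *)
Lemma suslin_bigcup (H : nat -> set (T * Y)) :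
  (forall k, suslin (H k)) -> suslin (\bigcup_k H k).
Proof.
move=> /(_ _)/cid2 sH; pose E k := sval (sH k).
have EP k : suslin_scheme (E k) by rewrite /E; case: (sH k).
have HE k : H k = scheme_set (E k) by rewrite /E; case: (sH k).
exists (fun m p => E (p 0%N) m (p \o succn)).
  split=> [m p|m p|m p].
  - by have [+ _ _] := EP (p 0%N); exact.
  - by have [_ + _] := EP (p 0%N); exact.
  - have [_ _ /(_ m (p \o succn))[N NP]] := EP (p 0%N).
    exists N.+1 => q pq; rewrite -(pq 0%N)//; apply: NP => i iN /=.
    by rewrite pq.
apply/seteqP; split => [x [k _]|x [p px]].
  rewrite HE => -[p px]; exists (fun i => if i is j.+1 then p j else k) => m.
  exact: px.
by exists (p 0%N) => //; rewrite HE; exists (p \o succn).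
Qed.

(** One index codes a sequence of indices, its column [k] being the index for [H k]. A level of the
    new scheme decodes to a pair: which scheme is tested, and at which level. *)
Lemma suslin_bigcap (H : nat -> set (T * Y)) :
  (forall k, suslin (H k)) -> suslin (\bigcap_k H k).
Proof.
move=> /(_ _)/cid2 sH; pose E k := sval (sH k).
have EP k : suslin_scheme (E k) by rewrite /E; case: (sH k).
have HE k : H k = scheme_set (E k) by rewrite /E; case: (sH k).
(* Numbers that code no pair are read as [(0, 0)], which only repeats one of the conditions. *)
pose dec m : nat * nat := odflt (0%N, 0%N) (unpickle m).
pose code (k m : nat) : nat := pickle (k, m).
have decK k m : dec (code k m) = (k, m) by rewrite /dec pickleK.
pose col k (p : nat -> nat) i := p (code k i).
exists (fun m p => E (dec m).1 (dec m).2 (col (dec m).1 p)).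
  split=> [m p|m p|m p].
  - by have [+ _ _] := EP (dec m).1; exact.
  - by have [_ + _] := EP (dec m).1; exact.
  - have [_ _ /(_ (dec m).2 (col (dec m).1 p))[N NP]] := EP (dec m).1.
    (* Fixing the first [N] entries of a column means fixing [p] up to the largest of their
       codes. *)
    exists (\max_(i < N) code (dec m).1 i).+1 => q pq.
    apply: NP => i iN; apply: pq; rewrite ltnS.
    exact: (@leq_bigmax _ (fun i : 'I_N => code (dec m).1 i)
      (Ordinal iN)).
apply/seteqP; split => [x Hx|x [p px] k _].
  have /choice[p pP] : forall k, exists p,
      forall m, (E k m p).1 x.1 /\ (E k m p).2 x.2.
    by move=> k; have := Hx k I; rewrite HE.
  exists (fun i => p (dec i).1 (dec i).2) => m.
  rewrite (_ : col _ _ = p (dec m).1)//.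
  by apply/funext => i; rewrite /col decK.
rewrite HE; exists (col k p) => m.
by have := px (code k m); rewrite decK.
Qed.

Lemma compact_closedI_norm_le (C : set Y) (k : nat) :
  closed C -> compact (C `&` [set v | `|v| <= k%:R]).
Proof.
move=> cC; apply: bounded_closed_compact.
  exists k%:R; split=> [|x kx v [_ /= vk]]; first exact: realn.
  by rewrite (le_trans vk)// ltW.
apply: closedI => //.
rewrite (_ : [set v | _] = (@Num.norm R Y) @^-1` [set x : R | x <= k%:R])//.
apply: preimage_closed; last exact: closed_le.
by move=> x _; exact: norm_continuous.
Qed.

Lemma suslin_closed_rect (A : set T) (C : set Y) :
  measurable A -> closed C -> suslin (A `*` C).
Proof.
move=> mA cC; rewrite (_ : A `*` C =
    \bigcup_k (A `*` (C `&` [set v | `|v| <= k%:R]))).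
  apply: suslin_bigcup => k; apply: suslin_rect => //.
  exact: compact_closedI_norm_le.
apply/seteqP; split=> [[t v] [/= At Cv]|[t v] [k _ [/= At [Cv _]]]]//.
exists (Num.truncn `|v|).+1 => //; split=> //; split=> //=.
by rewrite ltW// truncnS_gt.
Qed.

Lemma open_Fsigma (V : set Y) : open V ->
  exists2 F : nat -> set Y, forall k, closed (F k) & V = \bigcup_k F k.
Proof.
(* The [k]-th closed set holds the points at distance at least [1/(k+1)] from the complement of
   [V]. *)
move=> oV; exists (fun k => ~` \bigcup_(w in ~` V) ball w k.+1%:R^-1) => [k|].
  by apply: open_closedC; apply: bigcup_open => w _; exact: ball_open.
apply/seteqP; split=> [v Vv|v [k _ nv]].
  have /nbhs_ballP[e /= e0 eV] : nbhs v V by exact: open_nbhs_nbhs.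
  exists (Num.truncn e^-1) => // -[w nVw wv]; apply: nVw; apply: eV.
  apply: ball_sym; apply: le_ball wv; rewrite invf_ple ?posrE//.
  by rewrite ltW// truncnS_gt.
apply: contrapT => nVv; apply: nv; exists v => //.
exact: ballxx.
Qed.

(** Souslin sets need not be stable under complement, so the induction runs on the sets that are
    Souslin together with their complement. These form a sigma-algebra containing the measurable
    rectangles. *)
Lemma suslin_measurable (H : set (T * borelRV R n)) :
  measurable H -> suslin (H : set (T * Y)).
Proof.
pose G : set (set (T * Y)) := [set H | suslin H /\ suslin (~` H)].
have s0 : suslin (set0 : set (T * Y)).
  have -> : (set0 : set (T * Y)) = set0 `*` set0.
    by apply/seteqP; split=> // x [].
  by apply: suslin_closed_rect => //; exact: closed0.
have sT : suslin (setT : set (T * Y)).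
  by rewrite -setXTT; apply: suslin_closed_rect => //; exact: closedT.
have GC A : G A -> G (~` A) by move=> [sA sCA]; split=> //; rewrite setCK.
have GU (F : nat -> set (T * Y)) : (forall k, G (F k)) -> G (\bigcup_k F k).
  move=> GF; split; first by apply: suslin_bigcup => k; case: (GF k).
  by rewrite setC_bigcup; apply: suslin_bigcap => k; case: (GF k).
have GI A B : G A -> G B -> G (A `&` B).
  move=> GA GB; rewrite -[A `&` B]setCK setCI -bigcup2E; apply/GC.
  by apply: GU => -[|[|k]] /=; [exact: GC|exact: GC|split; rewrite ?setC0].
have GT A : measurable A -> G (A `*` setT).
  move=> mA; split; first by apply: suslin_closed_rect => //; exact: closedT.
  rewrite (_ : ~` _ = ~` A `*` setT).
    by apply: suslin_closed_rect; [exact: measurableC|exact: closedT].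
  by apply/seteqP; split=> [x /= nAx|x [/= nAx _] []//]; split=> // Ax; exact: nAx.
have GY : forall B : set (borelRV R n), measurable B -> G (setT `*` B).
  have GX (B : set Y) : (setT : set T) `*` ~` B = ~` (setT `*` B).
    apply/seteqP; split=> [x [_ nBx] []//|x nx]; split=> // Bx.
    exact: nx.
  apply: smallest_sub; first split => /=.
  - by rewrite setX0; split=> //; rewrite setC0.
  - by move=> A GA; rewrite setTD GX; exact: GC.
  - by move=> F GF; rewrite setX_bigcupr; exact: GU.
  move=> V oV /=; split.
    have [F cF ->] := open_Fsigma oV; rewrite setX_bigcupr.
    by apply: suslin_bigcup => k; exact: suslin_closed_rect.
  by rewrite -GX; apply: suslin_closed_rect => //; exact: open_closedC.
rewrite measurable_prod_measurableType => mH.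
suff : G H by case.
move: H mH; apply: smallest_sub; first split.
- by split=> //; rewrite setC0.
- by move=> A GA; rewrite setTD; exact: GC.
- exact: GU.
move=> _ [A mA [B mB <-]].
by rewrite -[A]setIT -[B]setTI setXI; apply: GI; [exact: GT|exact: GY].
Qed.

End Suslin.

(** * Random compact sets obtained from Souslin schemes *)

Section RandomCompact.
Context {d : measure_display} {T : measurableType d} {R : realType} {n : nat}.
Local Notation Y := 'rV[R]_n.

Lemma bigcap_compact_neq0 (F : nat -> set Y) :
  (forall k, compact (F k)) -> (forall k, F k.+1 `<=` F k) ->
  (forall k, F k !=set0) -> \bigcap_k F k !=set0.
Proof.
move=> cF dF nF.
have dec i j : (i <= j)%N -> F j `<=` F i.
  elim: j => [|j IH]; first by rewrite leqn0 => /eqP ->.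
  rewrite leq_eqVlt => /predU1P[->//|ij].
  exact: subset_trans (dF j) (IH ij).
have := cF 0%N; rewrite compact_In0; apply.
  exists F => [i _|i _]; last by rewrite setIidr//; exact: dec.
  by apply: compact_closed => //; exact: norm_hausdorff.
move=> D' _; have [v Fv] := nF (\max_(i <- finmap.enum_fset D') i)%N.
exists v => i /= iD'; apply: dec Fv.
by apply: (@leq_bigmax_seq _ _ xpredT (fun i => i)).
Qed.

(** Values may be empty; the domain is measurable because it is the event of hitting [setT]. *)
Definition random_compact (D : T -> set Y) :=
  (forall t, compact (D t)) /\
  forall C, closed C -> measurable [set t | D t `&` C !=set0].

(** The plan for this section: [scheme_level] imposes finitely many conditions, with an index that
    may depend on the level, while [scheme_bounded] asks for one index for all levels. The first is
    a finite union of rectangles, and compactness carries its properties to the second. *)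
Variable E : nat -> (nat -> nat) -> set T * set Y.
Hypothesis hE : suslin_scheme E.

Definition scheme_level (s : nat -> nat) (k : nat) (t : T) : set Y :=
  [set v | exists2 p, pointwise_le p s &
    forall m, (m <= k)%N -> (E m p).1 t /\ (E m p).2 v].

Definition scheme_bounded (s : nat -> nat) (t : T) : set Y :=
  [set v | exists2 p, pointwise_le p s & forall m, (E m p).1 t /\ (E m p).2 v].

(** [fan] turns the pointwise moduli of local constancy into one modulus valid for all indices below
    [s]. *)
Lemma scheme_uniform s k : exists N, forall p, pointwise_le p s ->
  forall q, agree N p q -> forall m, (m <= k)%N -> E m q = E m p.
Proof.
have [_ _ lE] := hE.
pose Q p N := forall m, (m <= k)%N -> forall q, agree N p q -> E m q = E m p.
have [p _||N NP] := @fan s Q.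
- have /choice[N NP] := fun m => lE m p.
  exists (\max_(m < k.+1) N m)%N => q qs pq m mk r qr.
  have mm : (N m <= \max_(m < k.+1) N m)%N.
    exact: (@leq_bigmax _ (fun m : 'I_k.+1 => N m) (Ordinal (mk : (m < k.+1)%N))).
  rewrite (NP m q (agree_le mm pq)) (NP m r)//.
  by apply: agree_le mm _; exact: agree_trans qr.
- by move=> p i j ij Qp m mk q /(agree_le ij); exact: Qp.
- by exists N => p ps q pq m mk; exact: NP.
Qed.

Lemma scheme_levelE s k : exists (I : finType) (q : I -> nat -> nat),
  (forall i, pointwise_le (q i) s) /\
  forall t, scheme_level s k t = \bigcup_(i in [set: I])
    [set v | forall m, (m <= k)%N -> (E m (q i)).1 t /\ (E m (q i)).2 v].
Proof.
have [N NP] := scheme_uniform s k.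
pose M := (\max_(i < N) s i).+1.
(* A prefix of length [N] becomes an index below [s] by padding with 0 and truncating at [s]. *)
pose q (f : {ffun 'I_N -> 'I_M}) i :=
  minn (s i) (if insub i is Some j then val (f j) else 0%N).
have qs f : pointwise_le (q f) s by move=> i; exact: geq_minl.
exists {ffun 'I_N -> 'I_M}, q; split=> // t.
apply/seteqP; split=> v; last by move=> [f _ fP]; exists (q f).
move=> [p ps pP].
have pM (i : 'I_N) : (p i < M)%N.
  by rewrite ltnS (leq_trans (ps i))//; exact: (leq_bigmax i).
exists [ffun i => Ordinal (pM i)] => // m mk.
rewrite (NP p ps)//; first exact: pP.
move=> i iN; rewrite /q insubT ffunE /=.
by apply/esym/minn_idPr; exact: ps.
Qed.

(** In the finite union of rectangles, whether the compact side meets [C] does not depend on [t], so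
    hitting [C] amounts to lying in one of finitely many measurable sides. *)
Lemma random_compact_level s k : random_compact (scheme_level s k).
Proof.
have [mE cE _] := hE; have [I [q [qs qE]]] := scheme_levelE s k.
have clE m p : closed (E m p).2.
  by apply: compact_closed; [exact: norm_hausdorff|exact: cE].
split=> [t|C cC].
  rewrite qE -bigsetU_fset_set; last exact: finite_finset.
  apply: bigsetU_compact => i _.
  apply: (@subclosed_compact _ _ (E 0%N (q i)).2) => //.
    have [At|nAt] := pselect (forall m, (m <= k)%N -> (E m (q i)).1 t).
      rewrite (_ : [set v | _] =
          \bigcap_(m in [set m | (m <= k)%N]) (E m (q i)).2).
        by apply: closed_bigI => m _.
      apply/seteqP; split=> v /= vP m mk; first by case: (vP m mk).
      by split; [exact: At|exact: vP].
    rewrite (_ : [set v | _] = set0); first exact: closed0.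
    by apply/seteqP; split=> v //= vP; apply: nAt => m /vP[].
  by move=> v /(_ 0%N isT)[].
rewrite (_ : [set t | _] = \bigcup_(i in [set: I])
    (\bigcap_(m in [set m | (m <= k)%N]) (E m (q i)).1 `&`
     [set t | C `&` \bigcap_(m in [set m | (m <= k)%N]) (E m (q i)).2 !=set0])).
  apply: fin_bigcup_measurable => [|i _]; first exact: finite_finset.
  apply: measurableI; first by apply: bigcap_measurable => //; exists 0%N.
  have [nC|C0] := pselect (C `&` \bigcap_(m in [set m | (m <= k)%N]) (E m (q i)).2
     !=set0).
    by rewrite (_ : [set t | _] = setT)//; apply/seteqP; split.
  by rewrite (_ : [set t | _] = set0)//; apply/seteqP; split.
apply/seteqP; split=> t /=; rewrite qE.
  move=> [v [[i _ iP] Cv]]; exists i => //.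
  by split=> [m mk|]; [case: (iP m mk)|exists v; split=> // m mk; case: (iP m mk)].
move=> [i _ [it [v [Cv iv]]]]; exists v; split=> //; exists i => // m mk.
by split; [exact: it|exact: iv].
Qed.

Lemma scheme_level_dec s k t : scheme_level s k.+1 t `<=` scheme_level s k t.
Proof. by move=> v [p ps pP]; exists p => // m mk; apply: pP; exact: leqW. Qed.

(** A point of all levels comes with a different index at each level. If no common index existed,
    each index below [s] would violate some condition, by [fan] one of number less than a uniform
    [N], against membership in level [N]. *)
Lemma bigcap_scheme_level s t :
  \bigcap_k scheme_level s k t = scheme_bounded s t.
Proof.
have [_ _ lE] := hE.
apply/seteqP; split=> [v vP|v [p ps pP] k _]; last by exists p.
apply: contrapT => nv.
have [p ps||N NP] := @fan s (fun p k => exists2 m, (m < k)%N &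
    ~ ((E m p).1 t /\ (E m p).2 v)).
- have /existsNP[m nm] : ~ forall m, (E m p).1 t /\ (E m p).2 v.
    by move=> pP; apply: nv; exists p.
  have [N NP] := lE m p; exists (maxn N m.+1) => q _ pq.
  exists m; first by rewrite leq_maxr.
  by rewrite NP//; apply: agree_le pq; exact: leq_maxl.
- by move=> p i j ij [m mi nm]; exists m => //; exact: leq_trans ij.
- have [p ps pP] := vP N I; have [m mN] := NP p ps.
  by apply; apply: pP; exact: ltnW.
Qed.

(** The levels are compact and decreasing, so by Cantor's intersection theorem hitting [C] commutes
    with their intersection. *)
Lemma hits_scheme_bounded s C : closed C ->
  [set t | scheme_bounded s t `&` C !=set0] =
  \bigcap_k [set t | scheme_level s k t `&` C !=set0].
Proof.
move=> cC; apply/seteqP; split=> [t [v []]|t tP].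
  by rewrite -bigcap_scheme_level => vP Cv k _; exists v; split=> //; exact: vP.
have [||k|v vP] := @bigcap_compact_neq0 (fun k => scheme_level s k t `&` C).
- move=> k; have [/(_ t) ck _] := random_compact_level s k.
  apply: (subclosed_compact _ ck) => //; apply: closedI => //.
  by apply: compact_closed ck; exact: norm_hausdorff.
- by move=> k; apply: setSI; exact: scheme_level_dec.
- exact: tP.
- exists v; split; last by case: (vP 0%N I).
  by rewrite -bigcap_scheme_level => k _; case: (vP k I).
Qed.

Lemma random_compact_bounded s : random_compact (scheme_bounded s).
Proof.
split=> [t|C cC]; last first.
  rewrite hits_scheme_bounded//; apply: bigcapT_measurable => k.
  by have [_] := random_compact_level s k; exact.
rewrite -bigcap_scheme_level.
have cl k := (random_compact_level s k).1 t.
apply: (subclosed_compact _ (cl 0%N)); last by move=> v; exact.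
by apply: closed_bigI => k _; apply: compact_closed (cl k); exact: norm_hausdorff.
Qed.

End RandomCompact.

Lemma countable_bigcapT_measurable (d : measure_display)
    (T : measurableType d) (I : Type) (F : I -> set T) :
  countable [set: I] -> (forall i, measurable (F i)) ->
  measurable (\bigcap_i F i).
Proof.
move=> cI mF; rewrite -[X in measurable X]setCK setC_bigcap.
apply: measurableC; apply: countable_bigcupT_measurable => // i.
exact: measurableC.
Qed.

(** * Capacitability and measurable selections *)

Section Capacity.
Context {d : measure_display} {T : measurableType d} {R : realType}.
Variable P : probability T R.

(* The outer measure of [Z] exceeds [a]; the strict inequality is what makes
   this stable under increasing unions. *)
Definition outer_gt (a : \bar R) (Z : set T) :=
  forall B, measurable B -> Z `<=` B -> (a < P B)%E.

Lemma outer_gt_sub a Z Z' : Z `<=` Z' -> outer_gt a Z -> outer_gt a Z'.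
Proof. by move=> ZZ' aZ B mB ZB; apply: aZ => //; exact: subset_trans ZB. Qed.

(** Otherwise each [Z k] has a measurable cover of probability at most [a], and continuity from
    below gives such a cover of the union. *)
Lemma outer_gt_bigcup a (Z : nat -> set T) :
  (forall i j, (i <= j)%N -> Z i `<=` Z j) ->
  outer_gt a (\bigcup_k Z k) -> exists k, outer_gt a (Z k).
Proof.
move=> Zmono aZ; apply: contrapT => nZ.
have /choice[B BP] : forall k, exists B,
    [/\ measurable B, Z k `<=` B & (P B <= a)%E].
  move=> k; apply: contrapT => nB; apply: nZ; exists k => B mB ZB.
  by rewrite ltNge; apply/negP => Ba; apply: nB; exists B.
(* The covers [B] need not increase; their tail intersections do, and still contain [Z k] because
   [Z] is increasing. *)
pose C k := \bigcap_(j in [set j | (k <= j)%N]) B j.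
have mC k : measurable (C k).
  by apply: bigcap_measurable => [|j _]; [exists k => /=|case: (BP j)].
have mU : measurable (\bigcup_k C k) by exact: bigcupT_measurable.
have CZ : \bigcup_k Z k `<=` \bigcup_k C k.
  move=> t [k _ Zt]; exists k => // j kj; have [_ ZB _] := BP j.
  by apply: ZB; exact: Zmono kj _ Zt.
have := aZ _ mU CZ; apply/negP; rewrite -leNgt.
apply: cvge_to_le (nondecreasing_cvg_mu mC mU _) _.
  by move=> i j ij; apply/subsetPset => t Ct l jl; apply: Ct; exact: leq_trans jl.
apply: nearW => k /=; have [mB _ Ba] := BP k.
apply: le_trans Ba; apply: le_measure; rewrite ?inE// => t.
by apply; exact: leqnn.
Qed.

Context {n : nat}.
Local Notation Y := 'rV[R]_n.

(* Choquet's capacitability argument: bounding one coordinate of the index at a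
   time keeps the outer measure of the projection above [a]. *)
Lemma suslin_capacity (E : nat -> (nat -> nat) -> set T * set Y) (a : \bar R) :
  suslin_scheme E -> outer_gt a [set t | exists v, scheme_set E (t, v)] ->
  exists s, (a <= P [set t | scheme_bounded E s t !=set0])%E.
Proof.
move=> hE aE.
(* The projection of the branches whose first [k] coordinates are bounded by [p]; as the bound on
   coordinate [k] grows, these sets increase to the one with coordinate [k] free. *)
pose H k p := [set t | exists v q, (forall i, (i < k)%N -> (q i <= p i)%N) /\
  forall m, (E m q).1 t /\ (E m q).2 v].
have [||k p|s sP] := @prefix_choice (fun k p => outer_gt a (H k p)) (fun=> 0%N).
- move=> k p q pq; apply: outer_gt_sub => t [v [r [rp rP]]].
  by exists v, r; split=> // i ik; rewrite -pq ?rp.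
- apply: outer_gt_sub aE => t [v [q qP]].
  by exists v, q; split.
- move=> aH; apply: outer_gt_bigcup.
    move=> i j ij t [v [q [qp qP]]]; exists v, q; split=> // l lk.
    apply: leq_trans (qp l lk) _.
    by rewrite /upd; case: ifP.
  apply: outer_gt_sub aH => t [v [q [qp qP]]].
  exists (q k) => //; exists v, q; split=> // i; rewrite ltnS leq_eqVlt /upd.
  case/predU1P => [->|ik]; first by rewrite eqxx.
  by case: eqP => [->//|_]; exact: qp.
exists s.
have mL k : measurable [set t | scheme_level E s k t `&` setT !=set0].
  by have [_] := random_compact_level hE s k; apply; exact: closedT.
have -> : [set t | scheme_bounded E s t !=set0] =
    [set t | scheme_bounded E s t `&` setT !=set0].
  by apply/seteqP; split=> t; rewrite /= setIT.
rewrite (hits_scheme_bounded hE s closedT).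
apply: cvge_to_ge (nonincreasing_cvg_mu _ mL _ _) _.
- exact: le_lt_trans (probability_le1 P (mL 0%N)) (ltry _).
- exact: bigcapT_measurable.
- apply/nonincreasing_seqP => k; apply/subsetPset => t [v [lv _]].
  by exists v; split=> //; exact: scheme_level_dec lv.
(* Level [k] sees only [N] coordinates of the index, so [H N s] lies in its domain: an index bounded
   by [s] below [N] may be replaced by its minimum with [s]. *)
apply: nearW => k; apply: ltW; have [N NP] := scheme_uniform hE s k.
apply: (sP N) => // t [v [q [qs qP]]]; exists v; split=> //.
exists (fun i => minn (q i) (s i)) => [i|m mk]; first exact: geq_minr.
rewrite -(NP (fun i => minn (q i) (s i)) _ q)//; first by move=> i; exact: geq_minr.
by move=> i iN; apply/minn_idPl; exact: qs.
Qed.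

End Capacity.

Section Selection.
Context {d : measure_display} {T : measurableType d} {R : realType} {n : nat}.
Local Notation Y := 'rV[R]_n.

Definition argmin (phi : Y -> R) (D : T -> set Y) (t : T) : set Y :=
  [set v | D t v /\ forall w, D t w -> phi v <= phi w].

Lemma argmin_neq0 (phi : Y -> R) (D : T -> set Y) t :
  continuous phi -> compact (D t) -> D t !=set0 -> argmin phi D t !=set0.
Proof.
move=> cphi cD D0.
have [c /set_mem Dc cmin] := compact_EVT_min D0 cD (continuous_subspaceT cphi).
by exists c; split=> // w /mem_set; exact: cmin.
Qed.

(** The minimisers hit [C] exactly when [D] meets [C] and the minimum over the part in [C] is no
    larger than the minimum over [D]. Testing sublevel sets at rational heights makes this a
    countable condition. *)
Lemma random_compact_argmin (phi : Y -> R) (D : T -> set Y) :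
  continuous phi -> random_compact D -> random_compact (argmin phi D).
Proof.
move=> cphi [cD mD].
have cle (c : R) : closed [set v | phi v <= c].
  apply: (@preimage_closed _ _ phi [set x | x <= c]) => [v _|].
    exact: cphi.
  exact: closed_le.
have clD t : closed (D t) by apply: compact_closed (cD t); exact: norm_hausdorff.
split=> [t|C cC].
  apply: (subclosed_compact _ (cD t)); last by move=> v [].
  rewrite (_ : argmin _ _ _ =
      D t `&` \bigcap_(w in D t) [set v | phi v <= phi w]).
    by apply: closedI => //; apply: closed_bigI => w _; exact: cle.
  by apply/seteqP; split.
rewrite (_ : [set t | _] = [set t | D t `&` C !=set0] `&`
  \bigcap_(q in [set: rat])
    (~` [set t | D t `&` [set v | phi v <= ratr q] !=set0] `|`
     [set t | D t `&` (C `&` [set v | phi v <= ratr q]) !=set0])).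
  apply: measurableI; first exact: mD.
  apply: countable_bigcapT_measurable => // q.
  apply: measurableU; last by apply: mD; exact: closedI.
  by apply: measurableC; exact: mD.
apply/seteqP; split=> t /=.
  move=> [v [[Dv vmin] Cv]]; split=> [|q _]; first by exists v.
  have [[w [Dw /= wq]]|nw] := pselect (D t `&` [set v | phi v <= ratr q] !=set0).
    by right; exists v; split=> //; split=> //=; rewrite (le_trans (vmin w Dw)).
  by left.
move=> [nDC tq].
have cDC : compact (D t `&` C).
  by apply: (subclosed_compact _ (cD t)) => //; exact: closedI.
have [v /set_mem[Dv Cv] vmin] :=
  compact_EVT_min nDC cDC (continuous_subspaceT cphi).
exists v; split=> //; split=> // w Dw; rewrite leNgt; apply/negP => wv.
have [q] := rat_in_itvoo wv; rewrite in_itv/= => /andP[wq qv].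
case: (tq q I) => [|[u [Du [Cu /= uq]]]].
  by apply; exists w; split=> //=; exact: ltW.
by have := vmin u (mem_set (conj Du Cu)); rewrite leNgt (le_lt_trans uq).
Qed.

(* Successive minimisation of all the coordinates leaves one point. *)
Lemma random_compact_selection (D : T -> set Y) : random_compact D ->
  exists2 f : T -> Y, measurable_fun [set: T] (f : T -> borelRV R n) &
    forall t, D t !=set0 -> D t (f t).
Proof.
move=> rD; pose co (i : 'I_n) (v : Y) := v 0 i.
have cco i : continuous (co i) by exact: coord_continuous.
pose L s := foldr (fun i => argmin (co i)) D s.
have rL s : random_compact (L s).
  by elim: s => //= i s IH; exact: random_compact_argmin.
have nL s t : D t !=set0 -> L s t !=set0.
  move=> D0; elim: s => //= i s IH; apply: argmin_neq0 => //.
  by have [+ _] := rL s; exact.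
have LD s t v : L s t v -> D t v by elim: s => //= i s IH [/IH].
have Luniq s t v w i : i \in s -> L s t v -> L s t w -> v 0 i = w 0 i.
  elim: s => //= j s IH; rewrite inE => /predU1P[->|/IH {}IH] [Lv vm] [Lw wm].
    by apply/eqP; rewrite eq_le [_ <= _]vm// [_ <= _]wm.
  exact: IH.
pose M := L (enum 'I_n).
have MP t : D t !=set0 -> M t (get (M t)).
  by move=> /(nL (enum 'I_n)) [v Mv]; apply: getPex; exists v.
have Munique t v : M t v -> v = get (M t).
  move=> Mv; have D0 : D t !=set0 by exists v; exact: LD Mv.
  apply/rowP => i; apply: Luniq Mv (MP t D0).
  by rewrite mem_enum.
exists (fun t => if `[< D t !=set0 >] then get (M t) else 0); last first.
  by move=> t D0; rewrite asboolT//; exact: LD (MP t D0).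
apply: measurable_fun_rV => i.
apply: (measurability _ (RGenCInfty.measurableE R)).
move=> _ [_ [c ->] <-]; rewrite setTI.
have cc : closed [set v : Y | c <= v 0 i].
  by apply: (@preimage_closed _ _ (co i) [set x | c <= x]) => [v _|];
    [exact: cco|exact: closed_ge].
have mdom : measurable [set t | D t !=set0].
  rewrite (_ : [set t | _] = [set t | D t `&` setT !=set0]).
    by have [_] := rD; apply; exact: closedT.
  by apply/seteqP; split=> t; rewrite /= setIT.
(* Where nonempty, [M t] is a singleton, so bounding the selected coordinate below means hitting a
   closed half-space. The second piece accounts for the default value 0 off the domain. *)
rewrite (_ : _ @^-1` _ = [set t | M t `&` [set v | c <= v 0 i] !=set0] `|`
    (~` [set t | D t !=set0] `&` [set _ | c <= 0])).
  apply: measurableU; first by have [_] := rL (enum 'I_n); exact.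
  apply: measurableI; first exact: measurableC.
  have [c0|c0] := boolP (c <= 0).
    by rewrite (_ : [set _ | _] = setT)//; apply/seteqP; split.
  by rewrite (_ : [set _ | _] = set0)//; apply/seteqP; split.
apply/seteqP; split=> t /=; rewrite in_itv/= andbT.
  have [D0|nD0] := pselect (D t !=set0).
    by rewrite asboolT// => ct; left; exists (get (M t)); split=> //; exact: MP.
  by rewrite asboolF// mxE; right.
case=> [[v [Mv cv]]|[nD0 c0]]; last by rewrite asboolF// mxE.
by rewrite asboolT -?(Munique t v Mv)//; exists v; exact: LD Mv.
Qed.

End Selection.

(** * Convergence in probability and concatenation *)

Section AlmostEverywhere.
Context {d : measure_display} {T : measurableType d} {R : realType}.
Variable P : probability T R.

Lemma ae_forall_countable (I : countType) (Q : I -> T -> Prop) :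
  (forall i, {ae P, forall t, Q i t}) -> {ae P, forall t, forall i, Q i t}.
Proof.
move=> aeQ; have : {ae P, forall t, forall k,
    if unpickle k is Some i then Q i t else True}.
  apply: ae_foralln => k; case: (unpickle k) => [i|]; first exact: aeQ.
  exact: nearW.
by apply: filterS => t Qt i; have := Qt (pickle i); rewrite pickleK.
Qed.

Lemma ae_exists_le (B : nat -> set T) :
  (forall k, measurable (B k)) ->
  (forall e : R, 0 < e -> exists k, (P (~` B k) <= e%:E)%E) ->
  {ae P, forall t, exists k, B k t}.
Proof.
move=> mB PB; exists (\bigcap_k ~` B k); split.
- by apply: bigcapT_measurable => k; exact: measurableC.
- apply/eqP; rewrite eq_le measure_ge0 andbT; apply/lee_addgt0Pr => e e0.
  rewrite add0e; have [k Pk] := PB e e0; apply: le_trans Pk.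
  apply: le_measure; rewrite ?inE//; last by move=> t; exact.
    by apply: bigcapT_measurable => j; exact: measurableC.
  exact: measurableC.
- by move=> t /= nB k _ Bt; apply: nB; exists k.
Qed.

Lemma ae_measurable (Q : T -> Prop) : {ae P, forall t, Q t} ->
  exists N : set T, [/\ measurable N, P N = 0%E & forall t, ~ N t -> Q t].
Proof.
move=> [N [mN PN QN]]; exists N; split=> // t nN.
by apply: contrapT => nQ; apply: nN; exact: QN.
Qed.

End AlmostEverywhere.

Lemma first_index_partition {d : measure_display} {T : measurableType d}
    (B : nat -> set T) : (forall k, measurable (B k)) ->
  exists A : mpartition T, forall t m, (exists k, B k t) -> A m t -> B m t.
Proof.
(* Cell 0 also absorbs the points outside every [B k], so that disjointifying yields a partition of
   the whole space. *)
move=> mB; pose B' k := if k is 0%N then B 0%N `|` ~` \bigcup_k B k else B k.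
have mB' k : measurable (B' k).
  case: k => [|k] //=; apply: measurableU => //; apply: measurableC.
  exact: bigcupT_measurable.
have cB' : \bigcup_k B' k = setT.
  apply/seteqP; split=> // t _.
  have [[k _ Bk]|nB] := pselect ((\bigcup_k B k) t); last by exists 0%N => //; right.
  by exists k => //; case: k Bk => [|k] //; left.
have sB' k : seqDU B' k `<=` B' k by move=> t [].
exists (@MPartition _ _ (seqDU B') (seqDU_measurable mB')
  (@trivIset_seqDU _ B') (etrans (esym (seqDU_bigcup_eq B')) cB')).
move=> t m [k Bk] /sB'; case: m => [|m] //= [//|nB].
by exfalso; apply: nB; exists k.
Qed.

Lemma binary_partition {d : measure_display} {T : measurableType d}
    (B : set T) : measurable B ->
  exists2 A : mpartition T, A 0%N = B & A 1%N = ~` B.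
Proof.
move=> mB; pose A k := if k is 0%N then B else if k is 1%N then ~` B else set0.
have mA k : measurable (A k) by case: k => [|[|k]] //=; exact: measurableC.
have tA : trivIset setT A.
  by move=> [|[|i]] [|[|j]] _ _ [t []].
have cA : \bigcup_k A k = setT.
  apply/seteqP; split=> // t _; have [Bt|nBt] := pselect (B t); first by exists 0%N.
  by exists 1%N.
by exists (MPartition mA tA cA).
Qed.

Lemma measurable_set_ler {d : measure_display} {T : measurableType d}
    {R : realType} (f g : T -> R) :
  measurable_fun [set: T] f -> measurable_fun [set: T] g ->
  measurable [set t | f t <= g t].
Proof.
move=> mf mg; rewrite -[X in measurable X]setTI.
exact: (measurable_fun_ler mf mg measurableT (Y := [set true])).
Qed.

Section EuclideanNorm.
Context {R : realType} {n : nat}.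
Implicit Types v w : 'rV[R]_n.

Lemma norm_le_enorm v : `|v| <= enorm v.
Proof.
rewrite [leLHS]/Num.norm/= mx_normrE; apply/bigmax_leP; split; first exact: sqrtr_ge0.
move=> [i j] _ /=; rewrite ord1 -sqrtr_sqr ler_sqrt; last first.
  by apply: sumr_ge0 => k _; exact: sqr_ge0.
rewrite (bigD1 j)//= lerDl; apply: sumr_ge0 => k _; exact: sqr_ge0.
Qed.

(** A crude constant, from [n <= (n+1)^2]; being positive for every [n], it can be divided by
    later. *)
Lemma enorm_le_norm v : enorm v <= n.+1%:R * `|v|.
Proof.
rewrite -[leRHS]ger0_norm ?mulr_ge0// -sqrtr_sqr ler_sqrt ?sqr_ge0//.
apply: (@le_trans _ _ (\sum_(i < n) `|v| ^+ 2)).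
  apply: ler_sum => i _; rewrite -real_normK ?num_real//.
  rewrite ler_pXn2r ?nnegrE//.
  rewrite [leRHS]/Num.norm/= mx_normrE.
  exact: (le_bigmax _ (fun ij => `|v ij.1 ij.2|) (0, i)).
rewrite sumr_const card_ord -[_ *+ n]mulr_natl exprMn ler_wpM2r ?sqr_ge0//.
by rewrite -natrX ler_nat (leq_trans (leqnSn n))// -{1}[n.+1]expn1 leq_pexp2l.
Qed.

End EuclideanNorm.

Section L0tools.
Context {d : measure_display} {T : measurableType d} {R : realType} {n : nat}.
Variable P : probability T R.
Local Notation Y := 'rV[R]_n.
Implicit Types (x y : L0V P n) (G : set (L0V P n)).

Lemma vfun_class (f : T -> borelRV R n) (mf : measurable_fun [set: T] f) :
  {ae P, forall t, vfun (L0class P mf : L0V P n) t = f t}.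
Proof. by apply: filterS (L0classE P mf) => t; exact. Qed.

Lemma L0V_ext x y : {ae P, forall t, vfun x t = vfun y t} -> x = y.
Proof. by move=> xy; apply/L0_eqP; apply: filterS xy => t + _. Qed.

Lemma selectionsP (U : T -> set Y) x :
  selections P U x <-> {ae P, forall t, U t (vfun x t)}.
Proof.
split=> [[x0 <- Ux0]|Ux].
  have := L0classE P (@measurable_funPT _ _ _ _ x0).
  have -> : L0class P (@measurable_funPT _ _ _ _ x0) =
      \pi_({mfun_ P, T >-> borelRV R n})%qT x0.
    by rewrite /L0class; congr (\pi_(_)%qT _); exact/val_inj.
  by move=> aex; apply: filterS2 Ux0 aex => t Ut /(_ I); rewrite /vfun => ->.
exists (repr x); [exact: reprK|exact: Ux].
Qed.

Lemma vfun_concat (A : mpartition T) (x : nat -> L0V P n) :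
  {ae P, forall t, forall m, A m t -> vfun (concat A x) t = vfun (x m) t}.
Proof.
apply: filterS (vfun_class (measurable_concat A x)) => t -> m Amt.
exact: concat_funE.
Qed.

Lemma closed_far G x : closed G ->
  (forall e : R, 0 < e -> exists2 y, G y & (P (far e x y) < e%:E)%E) -> G x.
Proof.
move=> cG Gx; apply: cG => B; rewrite -nbhs_entourageE => -[V].
move=> [[e l] /= [e0 l0] elV] VB.
have [|y Gy xy] := Gx (Num.min e l); first by rewrite lt_min e0.
exists y; split=> //; apply: VB; rewrite /xsection/= inE; apply: elV => /=.
apply: le_lt_trans (P_far_le x y _) (lt_le_trans xy _).
  by rewrite ge_min lexx.
by rewrite lee_fin ge_min lexx orbT.
Qed.

Lemma closure_far G x (e : R) : closure G x -> 0 < e ->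
  exists2 y, G y & (P (far e x y) < e%:E)%E.
Proof.
move=> Gx e0; have [|y [Gy xy]] := Gx [set y | (P (far e x y) < e%:E)%E].
  rewrite -nbhs_entourageE; exists [set xy | (P (far e xy.1 xy.2) < e%:E)%E].
    by exists (e, e).
  by move=> y; rewrite /xsection/= inE.
by exists y.
Qed.

(** The projection of the graph is the whole space, so its outer measure exceeds [1 - 1/(k+1)] for
    each [k]. Capacitability gives random compact subsets with domains that large; their selections
    are pasted along the first nonempty one. *)
Lemma measurable_graph_selection (U : T -> set Y) :
  measurable_graph U -> (forall t, U t !=set0) -> selections P U !=set0.
Proof.
move=> mU nU; have [E hE EU] := suslin_measurable mU.
have /choice[D DP] : forall k, exists D : T -> set Y,
    [/\ random_compact D, forall t, D t `<=` U t &
      ((1 - k.+1%:R^-1)%:E <= P [set t | D t !=set0])%E].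
  move=> k; have [|s sP] := @suslin_capacity _ _ _ P _ E (1 - k.+1%:R^-1)%:E hE.
    move=> B mB; rewrite -EU => UB.
    have -> : B = setT.
      by apply/seteqP; split=> // t _; apply: UB; exact: nU.
    by rewrite probability_setT lte_fin ltrBlDr ltrDl invr_gt0.
  exists (scheme_bounded E s); split=> //; first exact: random_compact_bounded.
  move=> t v [p _ pP].
  have : [set tv : T * borelRV R n | U tv.1 tv.2] (t, v) by rewrite EU; exists p.
  by [].
have /choice[f fP] : forall k, exists x : L0V P n,
    {ae P, forall t, D k t !=set0 -> U t (vfun x t)}.
  move=> k; have [rD DU _] := DP k; have [f mf fD] := random_compact_selection rD.
  exists (L0class P mf); apply: filterS (vfun_class mf) => t -> /fD.
  exact: DU.
have mdom k : measurable [set t | D k t !=set0].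
  have [[_ mD] _ _] := DP k.
  rewrite (_ : [set t | _] = [set t | D k t `&` setT !=set0]).
    by apply: mD; exact: closedT.
  by apply/seteqP; split=> t; rewrite /= setIT.
have [A AP] := first_index_partition mdom.
exists (concat A f); apply/selectionsP.
have aeD : {ae P, forall t, exists k, D k t !=set0}.
  apply: (ae_exists_le mdom) => e e0; exists (Num.truncn e^-1).
  have [_ _ Dk] := DP (Num.truncn e^-1).
  rewrite probability_setC// leeBlDr; last exact: fin_num_measure.
  apply: le_trans (leeD2l _ Dk); rewrite -EFinD lee_fin addrCA lerDl subr_ge0.
  by rewrite invf_ple ?posrE// ltW// truncnS_gt.
have aef : {ae P, forall t, forall k, D k t !=set0 -> U t (vfun (f k) t)}.
  exact: ae_foralln.
apply: filterS3 (vfun_concat A f) aef aeD => t cA fU exD.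
have [m _ Am] : (\bigcup_k A k) t by rewrite (mpart_cover A).
rewrite (cA m Am); apply: fU; exact: AP Am.
Qed.

(** The index [k] may vary with [t]: the event that every [y k] stays far from [x] lies in each
    single far event, and these have arbitrarily small probability. *)
Lemma ae_near_closure G x : closure G x ->
  exists2 y : nat -> L0V P n, (forall k, G (y k)) &
    {ae P, forall t, forall e, 0 < e -> exists k, `|vfun x t - vfun (y k) t| < e}.
Proof.
move=> Gx; have /choice[y yP] : forall k, exists y,
    G y /\ (P (far k.+1%:R^-1 x y) < (k.+1%:R^-1)%:E)%E.
  move=> k; have [|y Gy xy] := @closure_far G x k.+1%:R^-1 Gx; last by exists y.
  by rewrite invr_gt0.
exists y => [k|]; first by case: (yP k).
have : {ae P, forall t, forall j, exists k,
    (~` far j.+1%:R^-1 x (y k)) t}.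
  apply: ae_foralln => j; apply: ae_exists_le => [k|e e0].
    by apply: measurableC; exact: measurable_far.
  (* Being at least [j] controls the distance; being at least the truncation of [1/e] controls the
     probability. *)
  exists (maxn j (Num.truncn e^-1)); set k := maxn _ _.
  rewrite setCK; apply: (@le_trans _ _ (P (far k.+1%:R^-1 x (y k)))).
    by apply: P_far_le; rewrite lef_pV2 ?posrE// ler_nat ltnS leq_maxl.
  apply: le_trans (ltW (yP k).2) _; rewrite lee_fin invf_ple ?posrE//.
  apply: (@le_trans _ _ (Num.truncn e^-1).+1%:R); first by rewrite ltW// truncnS_gt.
  by rewrite ler_nat ltnS leq_maxr.
apply: filterS => t far_t e e0; have [k] := far_t (Num.truncn e^-1).
rewrite /far /= => /negP; rewrite -ltNge => xy; exists k.
apply: le_lt_trans (norm_le_enorm _) (lt_le_trans xy _).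
by rewrite invf_ple ?posrE// ltW// truncnS_gt.
Qed.

Lemma closed_selections (U : T -> set Y) :
  (forall t, closed (U t)) -> closed (selections P U).
Proof.
move=> cU x /ae_near_closure[y Uy xy]; apply/selectionsP.
have {Uy}aeU : {ae P, forall t, forall k, U t (vfun (y k) t)}.
  by apply: ae_foralln => k; apply/selectionsP; exact: Uy.
apply: filterS2 aeU xy => t Uy xy; apply: cU => B /nbhs_ballP[e /= e0 eB].
have [k xyk] := xy e e0; exists (vfun (y k) t); split=> //; apply: eB.
by rewrite -ball_normE.
Qed.

(* The [x k] nearly maximise the integral of [phi]: pasting [y] into [x k] where
   [phi] gains at least [e] for every [k] would exceed the supremum. *)
Lemma ess_sup_sequence G (phi : Y -> R) :
  G !=set0 ->
  (forall (A : mpartition T) (x : nat -> L0V P n),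
     (forall k, G (x k)) -> G (concat A x)) ->
  (forall v, 0 <= phi v <= 1) ->
  (forall x, measurable_fun [set: T] (phi \o vfun x)) ->
  exists2 x : nat -> L0V P n, (forall k, G (x k)) &
    forall y, G y -> {ae P, forall t, forall e, 0 < e ->
      exists k, phi (vfun y t) < phi (vfun (x k) t) + e}.
Proof.
move=> [x0 Gx0] cG phi01 mphi.
pose J x : \bar R := (\int[P]_t (phi (vfun x t))%:E)%E.
have phi0 v : 0 <= phi v by case/andP: (phi01 v).
have mphiE x : measurable_fun [set: T] (fun t => (phi (vfun x t))%:E).
  by apply/measurable_EFinP; exact: mphi.
have J1 x : (J x <= 1%:E)%E.
  apply: (@le_trans _ _ (\int[P]_t (cst 1%:E t))%E).
    apply: ge0_le_integral => //= t _; rewrite lee_fin//.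
    by case/andP: (phi01 (vfun x t)).
  by rewrite integral_cst// mul1e probability_le1.
have J0 x : (0 <= J x)%E by apply: integral_ge0 => t _; rewrite lee_fin.
pose S := [set fine (J x) | x in G].
have JE x : J x = (fine (J x))%:E.
  by rewrite fineK// ge0_fin_numE//; exact: le_lt_trans (J1 x) (ltry _).
have supS : has_sup S.
  split; first by exists (fine (J x0)), x0.
  exists 1 => _ [x _ <-]; by rewrite -lee_fin -JE.
have /choice[x xP] : forall k, exists x, G x /\ sup S - k.+1%:R^-1 < fine (J x).
  move=> k; have [|_ [x Gx <-] xS] := @sup_adherent _ S k.+1%:R^-1 _ supS.
    by rewrite invr_gt0.
  by exists x.
exists x => [k|y Gy]; first by case: (xP k).
have : {ae P, forall t, forall j, exists k,
    phi (vfun y t) < phi (vfun (x k) t) + j.+1%:R^-1}.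
  apply: ae_foralln => j; set e : R := j.+1%:R^-1.
  have e0 : 0 < e by rewrite invr_gt0.
  (* The event where [y] beats every [x k] by at least [e]; it has to be null. *)
  pose B := \bigcap_k [set t | phi (vfun (x k) t) + e <= phi (vfun y t)].
  have mB : measurable B.
    apply: bigcapT_measurable => k; apply: measurable_set_ler; last exact: mphi.
    by apply: measurable_funD => //; exact: mphi.
  exists B; split=> //; last first.
    move=> t /= nt k _ /=; rewrite leNgt; apply/negP => ?; apply: nt.
    by exists k.
  apply/eqP; rewrite eq_le measure_ge0 andbT leNgt; apply/negP => PB.
  have PBE : P B = (fine (P B))%:E by rewrite fineK// fin_num_measure.
  have p0 : 0 < fine (P B) by rewrite -lte_fin -PBE.
  set p := fine (P B) in PBE p0.
  (* For this [k] the integral of [x k] is within [e * p] of the supremum, and pasting [y] on [B]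
     raises it by at least [e * p]. *)
  pose k := Num.truncn (e * p)^-1.
  have kep : k.+1%:R^-1 < e * p.
    by rewrite invf_plt ?posrE ?mulr_gt0// truncnS_gt.
  have [A A0 A1] := binary_partition mB.
  pose w i := if i is 0%N then y else x k.
  have Gz : G (concat A w) by apply: cG => -[|i] //=; case: (xP k).
  have : fine (J (concat A w)) <= sup S.
    by apply: sup_upper_bound => //; exists (concat A w).
  apply/negP; rewrite -ltNge.
  apply: lt_le_trans (_ : fine (J (x k)) + e * p <= _).
    have [_] := xP k; move: kep; move: (k.+1%:R^-1) => c; lra.
  rewrite -lee_fin -JE EFinD -JE EFinM -PBE -integral_cst// integral_mkcond.
  have mcst : measurable_fun [set: T] ((cst e%:E : T -> \bar R) \_ B).
    apply/(measurable_restrictT _ _).1 => //.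
  have cst0 t : setT t -> (0 <= ((cst e%:E : T -> \bar R) \_ B) t)%E.
    by move=> _; rewrite patchE; case: ifP => // _; rewrite lee_fin ltW.
  have phiE0 x' t : setT t -> (0 <= (phi (vfun x' t))%:E)%E.
    by rewrite lee_fin.
  rewrite -ge0_integralD//; last exact: phiE0.
  apply: ae_ge0_le_integral => //.
  - by move=> t _; apply: adde_ge0; [exact: phiE0|exact: cst0].
  - exact: emeasurable_funD.
  - exact: phiE0.
  apply: filterS (vfun_concat A w) => t cA _; rewrite patchE.
  case: ifPn => [/set_mem Bt|/negP nBt].
    rewrite (cA 0%N) ?A0//= -EFinD lee_fin; exact: (Bt k I).
  rewrite (cA 1%N)/= ?adde0// A1 => Bt; apply: nBt; exact: mem_set.
apply: filterS => t xt e e0; have [k xk] := xt (Num.truncn e^-1).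
exists k; apply: lt_trans xk _; rewrite ltrD2l.
by rewrite invf_plt ?posrE// truncnS_gt.
Qed.

End L0tools.

Lemma convex_set_segment {R : realType} {V : lmodType R} (C : set V) :
  convex_set (C : set (convex_lmodType V)) <->
  forall x y (l : R), 0 <= l <= 1 -> C x -> C y -> C (l *: x + (1 - l) *: y).
Proof.
split=> [cC x y l /andP[l0 l1] Cx Cy|cC x y l /set_mem Cx /set_mem Cy].
  exact: (set_mem (cC x y (Itv01 l0 l1) (mem_set Cx) (mem_set Cy))).
by apply/mem_set/cC => //; rewrite ge0 le1.
Qed.

Section AbsFrac.
Context {R : realType}.
Implicit Types a b : R.

(** A bounded rescaling, strictly increasing on the half-line: it brings norms into the range
    required by [ess_sup_sequence], and comparisons transfer back. *)
Definition absfrac a : R := `|a| / (1 + `|a|).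

Let pos a : 0 < 1 + `|a|. Proof. by rewrite ltr_pwDl. Qed.

Lemma absfrac01 a : 0 <= absfrac a <= 1.
Proof. by rewrite divr_ge0//= ?ler_pdivrMr// ?mul1r ?lerDr// ltW. Qed.

Lemma absfrac_le a b : 0 <= a -> a <= b -> absfrac a <= absfrac b.
Proof.
move=> a0 ab; rewrite /absfrac !ger0_norm//; last exact: le_trans ab.
rewrite ler_pdivrMr ?ltr_pwDl// mulrAC ler_pdivlMr ?ltr_pwDl ?(le_trans a0)//.
nra.
Qed.

Lemma absfrac_lt a b : 0 <= a -> a < b -> absfrac a < absfrac b.
Proof.
move=> a0 ab; rewrite /absfrac !ger0_norm//; last exact: le_trans (ltW ab).
rewrite ltr_pdivrMr ?ltr_pwDl// mulrAC ltr_pdivlMr ?ltr_pwDl ?(le_trans a0) ?ltW//.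
nra.
Qed.

Lemma measurable_absfrac : measurable_fun [set: R] absfrac.
Proof.
apply: continuous_measurable_fun => a.
apply: cvgM; first exact: norm_continuous.
apply: cvgV; first by rewrite gt_eqF.
by apply: cvgD; [exact: cvg_cst|exact: norm_continuous].
Qed.

End AbsFrac.

(** * Selections of a random set *)

Section SelectionsToL0.
Context {d : measure_display} {T : measurableType d} {R : realType} {n : nat}.
Variable P : probability T R.
Local Notation Y := 'rV[R]_n.
Implicit Types (x y : L0V P n) (G : set (L0V P n)).

Lemma selections_concat (U : T -> set Y) (A : mpartition T) (x : nat -> L0V P n) :
  (forall k, selections P U (x k)) -> selections P U (concat A x).
Proof.
move=> Ux; apply/selectionsP.
have : {ae P, forall t, forall k, U t (vfun (x k) t)}.
  by apply: ae_foralln => k; apply/selectionsP.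
apply: filterS2 (vfun_concat A x) => t cA {}Ux.
have [m _ Am] : (\bigcup_k A k) t by rewrite (mpart_cover A).
by rewrite (cA m Am).
Qed.

(** On the cell [A m] the concatenation equals [x m], so locality determines its image there. *)
Lemma local_sigma_stable G (h : L0V P n -> L0V P n) :
  (forall (A : mpartition T) (x : nat -> L0V P n),
     (forall k, G (x k)) -> G (concat A x)) ->
  local_map G h -> sigma_stable_map G h.
Proof.
move=> cG lh A x Gx; apply: L0V_ext.
have : {ae P, forall t, forall m, A m t ->
    vfun (h (concat A x)) t = vfun (h (x m)) t}.
  apply: ae_foralln => m; apply: lh; [exact: cG|exact: Gx|exact: mpart_measurable|].
  by apply: filterS (vfun_concat A x) => t; exact.
apply: filterS2 (vfun_concat A (h \o x)) => t cA hA.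
have [m _ Am] : (\bigcup_k A k) t by rewrite (mpart_cover A).
by rewrite (cA m Am) (hA m Am).
Qed.

(** If [x = y] on [A], pasting [x] on [A] with [y] off [A] gives back [y]; stability then identifies
    [f y] with [f x] on [A]. *)
Lemma sigma_stable_local G (f : L0V P n -> L0V P n) :
  sigma_stable_map G f -> local_map G f.
Proof.
move=> sf x y A Gx Gy mA xy.
have [B B0 B1] := binary_partition mA.
pose w k := if k is 0%N then x else y.
have fw := sf B w (fun k => if k is 0%N then Gx else Gy).
have ywE : concat B w = y.
  apply: L0V_ext; apply: filterS2 (vfun_concat B w) xy => t cB xyt.
  have [At|nAt] := pselect (A t).
    by rewrite (cB 0%N) ?B0// xyt.
  by rewrite (cB 1%N) ?B1.
rewrite ywE in fw; apply: filterS (vfun_concat B (f \o w)) => t cB At.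
by rewrite fw (cB 0%N) ?B0.
Qed.

Lemma ae_L0fun_class (f : T -> R) (mf : measurable_fun [set: T] f) :
  {ae P, forall t, L0fun (L0class P mf) t = f t}.
Proof. by apply: filterS (L0classE P mf) => t; exact. Qed.

Lemma ae_L0barfun (r : L0R P) :
  {ae P, forall t, L0barfun (L0R_bar r) t = (L0fun r t)%:E}.
Proof.
have := L0classE P
  (measurableT_comp (@EFin_measurable R setT) (measurable_repr r)).
by apply: filterS => t; exact.
Qed.

Lemma vfun_conv (l : L0R P) x y :
  {ae P, forall t, vfun (L0add (L0scale l x) (L0scale (L0sub (L0cst P 1) l) y)) t =
    L0fun l t *: vfun x t + (1 - L0fun l t) *: vfun y t}.
Proof.
have h1 := vfun_class P (measurable_add (L0scale l x)
  (L0scale (L0sub (L0cst P 1) l) y)).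
have h2 := vfun_class P (measurable_scale l x).
have h3 := vfun_class P (measurable_scale (L0sub (L0cst P 1) l) y).
have h4 := ae_L0fun_class
  (measurable_funB (measurable_repr (L0cst P 1)) (measurable_repr l)).
have h5 := ae_L0fun_class (@measurable_cst _ _ T R setT 1).
have {h4 h5} h45 : {ae P, forall t,
    L0fun (L0sub (L0cst P 1) l) t = 1 - L0fun l t}.
  apply: filterS2 h4 h5 => t h4t h5t.
  exact: (etrans h4t (congr1 (fun c => c - L0fun l t) h5t)).
have {h2 h3} h23 : {ae P, forall t,
    vfun (L0scale l x) t = L0fun l t *: vfun x t /\
    vfun (L0scale (L0sub (L0cst P 1) l) y) t = (1 - L0fun l t) *: vfun y t}.
  by apply: filterS3 h2 h3 h45 => t h2t h3t <-.
by apply: filterS2 h1 h23 => t h1t [h2t h3t]; rewrite h1t h2t h3t.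
Qed.

Lemma L0convex_selections (U : T -> set Y) :
  (forall t, convex_set (U t : set (convex_lmodType Y))) ->
  L0convex (selections P U).
Proof.
move=> cU x y l /selectionsP Ux /selectionsP Uy l0 l1; apply/selectionsP.
have l01 : {ae P, forall t, 0 <= L0fun l t <= 1}.
  have := ae_L0fun_class (@measurable_cst _ _ T R setT 0).
  have := ae_L0fun_class (@measurable_cst _ _ T R setT 1).
  move=> c1 c0; apply: filterS2 (filterI c0 c1) (filterI l0 l1) => t.
  rewrite /L0cst => -[/= c0t c1t] [l0t l1t].
  by rewrite -[X in X <= _ <= _]c0t -[X in _ <= _ <= X]c1t l0t l1t.
apply: filterS3 (vfun_conv l x y) l01 (filterI Ux Uy).
move=> t -> l01t [Uxt Uyt].
by have /convex_set_segment := cU t; exact.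
Qed.

Lemma ae_L0bar_norm x : {ae P, forall t,
  L0barfun (L0R_bar (L0norm x)) t = (enorm (vfun x t))%:E}.
Proof.
apply: filterS2 (ae_L0barfun (L0norm x))
  (ae_L0fun_class (measurable_enorm (measurable_vfun_coord x))) => t ->.
by rewrite /L0norm => ->.
Qed.

(** The supremum is realised by countably many selections that nearly maximise the rescaled norm. At
    almost every [t] all of them lie in the bounded set [U t], so it is finite. *)
Lemma as_bounded_selections (U : T -> set Y) :
  selections P U !=set0 -> (forall t, bounded_set (U t)) ->
  as_bounded (selections P U).
Proof.
move=> nG bU.
have e0 (v : Y) : 0 <= enorm v by exact: sqrtr_ge0.
have [||x Ux xP] := ess_sup_sequence (phi := absfrac \o @enorm R n) nG
  (selections_concat (U := U)).
- by move=> v; exact: absfrac01.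
- move=> x; apply: (measurableT_comp measurable_absfrac).
  by apply: measurable_enorm => i; exact: measurable_vfun_coord.
pose u k t := (enorm (vfun (x k) t))%:E.
pose s t := esups (u ^~ t) 0%N.
have sE t : s t = ereal_sup (range (u ^~ t)).
  rewrite /s /esups/= /sdrop; congr ereal_sup.
  by apply/seteqP; split=> _ [k _ <-]; exists k.
have mu_ k : measurable_fun [set: T] (u k).
  by apply/measurable_EFinP; apply: measurable_enorm => i; exact: measurable_vfun_coord.
have ms : measurable_fun [set: T] s by exact: measurable_fun_esups.
have mr : measurable_fun [set: T] (fine \o s) by exact: measurableT_comp.
pose r : L0R P := L0class P mr.
have aeU : {ae P, forall t, forall k, U t (vfun (x k) t)}.
  by apply: ae_foralln => k; apply/selectionsP.
have us k t : (u k t <= s t)%E by rewrite sE; apply: ereal_sup_ubound; exists k.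
have aes : {ae P, forall t, s t = (fine (s t))%:E}.
  apply: filterS aeU => t Ut; rewrite fineK// ge0_fin_numE.
    have [M [_ MP]] := bU t.
    apply: (@le_lt_trans _ _ (n.+1%:R * (M + 1))%:E); last exact: ltry.
    rewrite sE; apply: ge_ereal_sup => _ [k _ <-]; rewrite lee_fin.
    apply: le_trans (enorm_le_norm _) _; rewrite ler_wpM2l//.
    by apply: MP (Ut k); rewrite ltrDl.
  by apply: le_trans (us 0%N t); rewrite lee_fin.
have aer : {ae P, forall t, (L0fun r t)%:E = s t}.
  by apply: filterS2 (ae_L0fun_class mr) aes => t -> ->.

exists r.
  have := ae_L0fun_class (@measurable_cst _ _ T R setT 0).
  apply: filterS2 aer => t rs c0; rewrite /L0cst c0 -lee_fin rs.
  by apply: le_trans (us 0%N t); rewrite lee_fin.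
split=> [_ [y Uy <-]|v vP].
  apply: filterS3 (filterI (ae_L0bar_norm y) (ae_L0barfun r)) aer (xP y Uy).
  move=> t [-> ->] rs yx; rewrite rs leNgt; apply/negP.
  rewrite -rs lte_fin => ry.
  have rx k : enorm (vfun (x k) t) <= L0fun r t by rewrite -lee_fin rs us.
  have r0 : 0 <= L0fun r t := le_trans (e0 _) (rx 0%N).
  (* If [y] exceeded [r] at [t], this positive gap would be a tolerance that no [x k] meets, all
     being bounded by [r]. *)
  have [|k] := yx (absfrac (enorm (vfun y t)) - absfrac (L0fun r t)).
    by rewrite subr_gt0 absfrac_lt.
  apply/negP; rewrite -leNgt /= addrCA gerDl subr_le0.
  by rewrite absfrac_le.
have aev : {ae P, forall t, forall k, (u k t <= L0barfun v t)%E}.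
  apply: ae_foralln => k; have vk : {ae P, forall t,
      (L0barfun (L0R_bar (L0norm (x k))) t <= L0barfun v t)%O}.
    by apply: vP; exists (x k).
  by apply: filterS2 (ae_L0bar_norm (x k)) vk => t ->.
apply: filterS3 aev aer (ae_L0barfun r) => t uv rs ->; rewrite rs sE.
by apply: ge_ereal_sup => _ [k _ <-].
Qed.

End SelectionsToL0.

Lemma rational_row_dense {R : realType} {n : nat} (v : 'rV[R]_n) (e : R) :
  0 < e -> exists q : 'rV[rat]_n, `|v - map_mx ratr q| < e.
Proof.
move=> e0.
have /choice[r rP] : forall i : 'I_n, exists r : rat,
    ratr r \in `](v 0 i - e), (v 0 i + e)[.
  by move=> i; apply: rat_in_itvoo; lra.
exists (\row_i r i); suff : ball v e (map_mx ratr (\row_i r i)).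
  by rewrite -ball_normE.
split=> // i j; rewrite ord1 !mxE /ball/=.
by have := rP j; rewrite in_itv/= => /andP[? ?]; rewrite ltr_norml; lra.
Qed.

(** * Closed L0-convex sets *)

Section L0ToSelections.
Context {d : measure_display} {T : measurableType d} {R : realType} {n : nat}.
Variable P : probability T R.
Local Notation Y := 'rV[R]_n.
Implicit Types (x y : L0V P n) (G : set (L0V P n)).

Lemma P_far_ae_eq (C : set T) x y (e : R) : measurable C -> 0 < e ->
  {ae P, forall t, C t -> vfun x t = vfun y t} -> (P (far e x y) <= P (~` C))%E.
Proof.
move=> mC e0 /ae_measurable[N [mN PN NP]].
have {}PN : (P N <= 0)%E by rewrite PN.
apply: (@le_trans _ _ (P (~` C `|` N))).
  apply: le_measure; rewrite ?inE.
  - exact: measurable_far.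
  - by apply: measurableU => //; exact: measurableC.
  move=> t xyt; have [Nt|nNt] := pselect (N t); first by right.
  left=> Ct; move: xyt; rewrite /far/= (NP t nNt Ct) subrr /enorm big1 ?sqrtr0.
    by rewrite leNgt e0.
  by move=> i _; rewrite mxE expr0n.
apply: le_trans (measureU2 _ _ _) _ => //; first exact: measurableC.
by rewrite -[leRHS]adde0; apply: leeD2l; exact: PN.
Qed.

(** Finite pastings are convex combinations with indicator coefficients. They differ from the full
    concatenation only on the cells not yet reached, whose total probability tends to 0. *)
Lemma L0convex_concat G : closed G -> L0convex G ->
  forall (A : mpartition T) (x : nat -> L0V P n),
    (forall k, G (x k)) -> G (concat A x).
Proof.
move=> cG convG A x Gx.
have /choice[l lP] : forall k, exists l : L0R P,
    {ae P, forall t, L0fun l t = \1_(A k) t}.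
  move=> k; have mI : measurable_fun [set: T] (\1_(A k) : T -> R).
    exact: measurable_indic (mpart_measurable A k).
  by exists (L0class P mI); exact: ae_L0fun_class.
have l0 k : L0plus (l k).
  apply: filterS2 (lP k) (ae_L0fun_class P (@measurable_cst _ _ T R setT 0)).
  by move=> t + c0; rewrite /L0cst c0 => ->; rewrite indicE.
have l1 k : L0le (l k) (L0cst P 1).
  apply: filterS2 (lP k) (ae_L0fun_class P (@measurable_cst _ _ T R setT 1)).
  by move=> t + c0; rewrite /L0cst c0 => ->; rewrite indicE; case: (_ \in _).
(* Each step installs [x j] on [A j] and leaves the rest; cells not yet reached carry [x 0]. *)
pose fix z k := if k is j.+1 then
  L0add (L0scale (l j) (x j)) (L0scale (L0sub (L0cst P 1) (l j)) (z j)) else x 0%N.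
have Gz k : G (z k) by elim: k => //= k IH; exact: convG.
have zP k : {ae P, forall t, forall m, (m < k)%N -> A m t ->
    vfun (z k) t = vfun (x m) t}.
  elim: k => [|k IH] /=; first exact: nearW.
  apply: filterS3 (vfun_conv (l k) (x k) (z k)) (lP k) IH => t -> -> zk m.
  rewrite ltnS leq_eqVlt indicE => /predU1P[->|mk] Amt.
    by rewrite mem_set// scale1r subrr scale0r addr0.
  rewrite memNset ?scale0r ?add0r ?subr0 ?scale1r; first exact: zk.
  move=> Akt.
  have /trivIsetP/(_ m k I I) := @mpart_trivIset _ _ A.
  by rewrite (ltn_eqF mk) => /(_ isT)/seteqP[/(_ t (conj Amt Akt))].
apply: closed_far => // e e0.
pose C k := \bigcup_(m in [set m | (m < k)%N]) A m.
have mC k : measurable (C k).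
  by apply: bigcup_measurable => m _; exact: mpart_measurable.
have CP k : (P (far e (concat A x) (z k)) <= P (~` C k))%E.
  apply: P_far_ae_eq => //.
  apply: filterS2 (vfun_concat A x) (zP k) => t cA zk [m /= mk Amt].
  by rewrite (cA m Amt) (zk m mk).
have : P (~` C k) @[k --> \oo] --> P (\bigcap_k ~` C k).
  apply: nonincreasing_cvg_mu => //.
  - by apply: le_lt_trans (probability_le1 P _) (ltry _); exact: measurableC.
  - by move=> k; exact: measurableC.
  - by apply: bigcapT_measurable => k; exact: measurableC.
  - move=> i j ij; apply/subsetPset; apply: subsetC => t [m /= mi Am].
    by exists m => //=; exact: leq_trans ij.
rewrite (_ : \bigcap_k _ = set0) ?measure0; last first.
  apply/seteqP; split=> // t Ct.
  have [m _ Am] : (\bigcup_k A k) t by rewrite (mpart_cover A).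
  by apply: (Ct m.+1 I); exists m => /=.
move=> /fine_cvgP[_ /cvgrPdist_lt /(_ e e0)[k _ /(_ k (leqnn k))]] /=.
rewrite sub0r normrN => Pk; exists (z k); first exact: Gz.
apply: le_lt_trans (CP k) _; rewrite -[P _]fineK ?lte_fin ?fin_num_measure//.
  exact: le_lt_trans (ler_norm _) Pk.
exact: measurableC.
Qed.

Lemma ae_dense_sequence G : G !=set0 ->
  (forall (A : mpartition T) (x : nat -> L0V P n),
     (forall k, G (x k)) -> G (concat A x)) ->
  exists2 x : nat -> L0V P n, (forall k, G (x k)) &
    forall y, G y -> {ae P, forall t, forall e, 0 < e ->
      exists k, `|vfun y t - vfun (x k) t| < e}.
Proof.
move=> G0 cG.
(* Maximising [phi q] is minimising the distance to [q]. *)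
pose phi (q : 'rV[rat]_n) (v : Y) : R := 1 - absfrac (enorm (v - map_mx ratr q)).
have /choice[w wP] : forall q, exists w : nat -> L0V P n, (forall k, G (w k)) /\
    forall y, G y -> {ae P, forall t, forall e, 0 < e ->
      exists k, phi q (vfun y t) < phi q (vfun (w k) t) + e}.
  move=> q; have [||w Gw wP] := ess_sup_sequence (phi := phi q) G0 cG.
  - move=> v; have /andP[s0 s1] := @absfrac01 R (enorm (v - map_mx ratr q)).
    by rewrite /phi subr_ge0 s1 gerBl.
  - move=> x; apply: measurable_funB => //.
    apply: (measurableT_comp measurable_absfrac).
    apply: measurable_enorm => i.
    rewrite (_ : (fun t => _) = (fun t => vfun x t 0 i - ratr (q 0 i))).
      by apply: measurable_funB => //; exact: measurable_vfun_coord.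
    by apply/funext => t; rewrite !mxE.
  by exists w.
have [x0 Gx0] := G0.
exists (fun k => if unpickle k is Some qk then w qk.1 qk.2 else x0).
  by move=> k; case: unpickle => [[q j]|//]; exact: (wP q).1.
move=> y Gy.
have := ae_forall_countable (fun q => (wP q).2 y Gy).
apply: filterS => t yw e e0.
have [|q qy] := @rational_row_dense R n (vfun y t) (n.+1%:R^-1 * (e / 4)).
  by rewrite mulr_gt0// divr_gt0.
have ey : enorm (vfun y t - map_mx ratr q) <= e / 4.
  apply: le_trans (enorm_le_norm _) _.
  by rewrite -ler_pdivlMl//; exact: ltW.
(* As [y] is within [e / 4] of [q], this tolerance forces some member to within [e / 2] of [q],
   hence to less than [e] from [y]. *)
have [|k kP] := yw q (absfrac (e / 2) - absfrac (e / 4)).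
  by rewrite subr_gt0 absfrac_lt//; lra.
exists (pickle (q, k)); rewrite pickleK /=.
have wk : enorm (vfun (w q k) t - map_mx ratr q) < e / 2.
  rewrite ltNge; apply/negP => ew.
  have := @absfrac_le R (e / 2) _ _ ew.
  have := @absfrac_le R _ (e / 4) (sqrtr_ge0 _) ey.
  by move: kP; rewrite /phi; lra.
rewrite (_ : vfun y t - _ = (vfun y t - map_mx ratr q) -
  (vfun (w q k) t - map_mx ratr q)); last by rewrite opprB addrA subrK.
apply: le_lt_trans (ler_normB _ _) _.
have := le_trans (norm_le_enorm _) ey; have := le_lt_trans (norm_le_enorm _) wk.
by lra.
Qed.

End L0ToSelections.

(** * The closure of a random sequence *)

Section RandomClosure.
Context {d : measure_display} {T : measurableType d} {R : realType} {n : nat}.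
Variable P : probability T R.
Local Notation Y := 'rV[R]_n.
Implicit Types (x y : L0V P n) (G : set (L0V P n)).

(** This is the closure of the range of [u], isolated terms included. *)
Definition limit_points (u : nat -> Y) : set Y :=
  [set v | forall e, 0 < e -> exists k, `|v - u k| < e].

Lemma closed_limit_points u : closed (limit_points u).
Proof.
move=> v vL e e0; have e2 : 0 < e / 2 by rewrite divr_gt0.
have [w [wL vw]] := vL (ball v (e / 2)) (nbhsx_ballx _ _ e2).
have [k wk] := wL (e / 2) e2; exists k.
move: vw; rewrite -ball_normE /= => vw; rewrite [e]splitr.
rewrite (_ : v - u k = (v - w) + (w - u k)); last by rewrite addrA subrK.
exact: le_lt_trans (ler_normD _ _) (ltrD vw wk).
Qed.

Lemma bounded_limit_points u M :
  (forall k, `|u k| <= M) -> bounded_set (limit_points u).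
Proof.
move=> uM; exists (M + 1); split=> [|x Mx v vL]; first exact: num_real.
have [k vk] := vL 1 ltr01.
rewrite (_ : v = (v - u k) + u k); last by rewrite subrK.
apply: le_trans (ler_normD _ _) _; have := uM k; lra.
Qed.

(** Rational combinations of the terms suffice: the end points are approximated by terms and the
    coefficient by a rational, [M] bounding the cost of the latter. *)
Lemma convex_limit_points u M : (forall k, `|u k| <= M) ->
  (forall i j (q : rat), 0 <= q <= 1 ->
     limit_points u (ratr q *: u i + (1 - ratr q) *: u j)) ->
  convex_set (limit_points u : set (convex_lmodType Y)).
Proof.
move=> uM uconv; apply/convex_set_segment => v w l l01 vL wL e e0.
have M0 : 0 <= M by exact: le_trans (uM 0%N).
have [|i vi] := vL (e / 8); first by rewrite divr_gt0.
have [|j wj] := wL (e / 8); first by rewrite divr_gt0.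
(* Chosen so that [c * (2 * M)] is at most [e / 4]; the four errors then sum to less than [e]. *)
pose c := e / (8 * (M + 1)).
have M8 : 0 < 8 * (M + 1) by rewrite mulr_gt0// ltr_wpDl.
have c0 : 0 < c by rewrite divr_gt0.
have [q q01 lq] : exists2 q : rat, 0 <= q <= 1 & `|l - ratr q| < c.
  have [l0 l1] := andP l01.
  (* Clipping to the unit interval leaves a nonempty open interval even when [l] is 0 or 1. *)
  have [|q] := @rat_in_itvoo R (Num.max 0 (l - c)) (Num.min 1 (l + c)).
    rewrite gt_max !lt_min ltr01 ltr_wpDl//= ltrBlDr ltr_pwDr//=.
    by rewrite ltrBlDr -addrA ltrDl addr_gt0.
  rewrite in_itv/= gt_max lt_min => /andP[/andP[q0 lq] /andP[q1 ql]].
  exists q; last by rewrite ltr_norml; apply/andP; split; lra.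
  by apply/andP; split; rewrite -(ler_rat R) ?rmorph0 ?rmorph1 ltW.
have [|k kP] := uconv i j q q01 (e / 4); first by rewrite divr_gt0.
exists k.
set r : R := ratr q in lq kP.
rewrite (_ : l *: v + (1 - l) *: w - u k =
  (l *: (v - u i) + (1 - l) *: (w - u j) + (l - r) *: (u i - u j)) +
  (r *: u i + (1 - r) *: u j - u k)); last first.
  by apply/rowP => z; rewrite !mxE; ring.
have [l0 l1] := andP l01.
have b1 : `|l *: (v - u i)| <= e / 8.
  by rewrite normrZ ger0_norm// -[leRHS]mul1r ler_pM// ltW.
have b2 : `|(1 - l) *: (w - u j)| <= e / 8.
  by rewrite normrZ ger0_norm ?subr_ge0// -[leRHS]mul1r ler_pM ?subr_ge0 ?gerBl// ltW.
have b3 : `|(l - r) *: (u i - u j)| <= e / 4.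
  rewrite normrZ; apply: (@le_trans _ _ (c * (M + M))).
    apply: ler_pM => //; first exact: ltW.
    by apply: le_trans (ler_normB _ _) _; exact: lerD.
  have : c * (8 * (M + 1)) = e by rewrite /c mulfVK// gt_eqF.
  by move: c0; clear; move: c => c; nra.
have := ler_normD (l *: (v - u i) + (1 - l) *: (w - u j) + (l - r) *: (u i - u j))
  (r *: u i + (1 - r) *: u j - u k).
have := ler_normD (l *: (v - u i) + (1 - l) *: (w - u j)) ((l - r) *: (u i - u j)).
have := ler_normD (l *: (v - u i)) ((1 - l) *: (w - u j)).
by move: b1 b2 b3 kP e0; clear; lra.
Qed.

(** The value at an exceptional point is a singleton, so that boundedness and convexity hold at
    every [t], not only almost surely. *)
Definition random_closure (N : set T) (x : nat -> L0V P n) (t : T) : set Y :=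
  if `[< N t >] then [set 0] else limit_points (fun k => vfun (x k) t).

Lemma measurable_graph_random_closure N (x : nat -> L0V P n) :
  measurable N -> measurable_graph (random_closure N x).
Proof.
move=> mN; rewrite /measurable_graph.
pose g k (tv : T * borelRV R n) : borelRV R n := (tv.2 : Y) - vfun (x k) tv.1.
have mcoord i : measurable_fun [set: T * borelRV R n]
    (fun tv => (tv.2 : Y) 0 i).
  exact: (measurable_fun_coord i (@measurable_snd _ _ T (borelRV R n))).
have mg k : measurable_fun [set: T * borelRV R n] (g k).
  apply: measurable_fun_rV => i.
  rewrite (_ : (fun tv => _) = (fun tv : T * borelRV R n =>
      (tv.2 : Y) 0 i - vfun (x k) tv.1 0 i)).
    apply: measurable_funB => //.
    exact: (measurableT_comp (measurable_vfun_coord (x k) i) measurable_fst).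
  by apply/funext => tv; rewrite !mxE.
have mball k (e : R) : measurable [set tv : T * borelRV R n | `|g k tv| < e].
  rewrite -[X in measurable X]setTI; apply: (mg k measurableT [set v : Y | `|v| < e]).
  apply: sub_sigma_algebra.
  rewrite (_ : [set v | _] = (@Num.norm R Y) @^-1` [set z : R | z < e])//.
  by apply: open_comp; [move=> v _; exact: norm_continuous|exact: open_lt].
rewrite (_ : [set tv | _] =
  ((N `*` setT) `&` \bigcap_(i in [set: 'I_n])
     [set tv : T * borelRV R n | (tv.2 : Y) 0 i \in `[0, 0]]) `|`
  ((~` N `*` setT) `&` \bigcap_j \bigcup_k
    [set tv : T * borelRV R n | `|g k tv| < j.+1%:R^-1])).
  apply: measurableU; apply: measurableI.
  - exact: measurableX.
  - apply: fin_bigcap_measurable => [|i _]; first exact: finite_finset.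
    rewrite -[X in measurable X]setTI.
    exact: (mcoord i measurableT _ (measurable_itv `[0, 0])).
  - by apply: measurableX => //; exact: measurableC.
  - apply: bigcapT_measurable => j; apply: bigcupT_measurable => k.
    exact: mball.
apply/seteqP; split=> -[t v] /=; rewrite /random_closure.
  case: asboolP => [Nt /= ->|nNt vL].
    left; split=> // i _ /=; first by rewrite mxE in_itv/= lexx.
  right; split=> // j _.
  by have [|k] := vL j.+1%:R^-1; [rewrite invr_gt0|exists k].
move=> [[[Nt _] v0]|[[nNt _] vL]].
  rewrite asboolT//=; apply/rowP => i; have := v0 i I.
  by rewrite /= in_itv/= mxE => /andP[? ?]; apply/eqP; rewrite eq_le; apply/andP.
rewrite asboolF// => e e0; have [k _ kP] := vL (Num.truncn e^-1) I.
exists k; apply: lt_trans kP _.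
by rewrite invf_plt ?posrE// truncnS_gt.
Qed.

(** A selection of the closure is approximated within any [e] by pasting, at each [t], the first
    [x k] that is [e]-close to it; closedness of [G] concludes. The converse inclusion is
    density. *)
Lemma selections_random_closure G N (x : nat -> L0V P n) : closed G ->
  (forall (A : mpartition T) (x : nat -> L0V P n),
     (forall k, G (x k)) -> G (concat A x)) ->
  measurable N -> P N = 0%E -> (forall k, G (x k)) ->
  (forall y, G y -> {ae P, forall t, forall e, 0 < e ->
      exists k, `|vfun y t - vfun (x k) t| < e}) ->
  selections P (random_closure N x) = G.
Proof.
move=> cG concatG mN PN Gx xdense.
have aeN : {ae P, forall t, ~ N t}.
  by exists N; split=> // t /= /contrapT.
apply/seteqP; split=> y; last first.
  move=> /xdense yx; apply/selectionsP; apply: filterS2 aeN yx => t nNt yx.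
  by rewrite /random_closure asboolF.
move=> /selectionsP yU.
apply: closed_far => // e e0.
have mB k : measurable (~` far e y (x k)).
  by apply: measurableC; exact: measurable_far.
have [A AP] := first_index_partition mB.
exists (concat A x); first exact: concatG.
rewrite (_ : P _ = 0%E) ?lte_fin//.
apply: measure_negligible; first exact: measurable_far.
apply: negligibleS (_ : P.-negligible (~` [set t | (~` far e y (concat A x)) t])).
  by move=> t /= yt nyt; exact: nyt yt.
apply: filterS3 (vfun_concat A x) aeN yU => t cA nNt.
rewrite /random_closure asboolF// => yL.
have [|k yk] := yL (n.+1%:R^-1 * e); first by rewrite mulr_gt0.
have [m _ Am] : (\bigcup_k A k) t by rewrite (mpart_cover A).
have : (~` far e y (x m)) t.
  apply: AP Am; exists k; rewrite /far /=; apply/negP.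
  rewrite -ltNge; apply: le_lt_trans (enorm_le_norm _) _.
  by rewrite -ltr_pdivlMl.
by rewrite /far /= (cA m Am).
Qed.

End RandomClosure.

(** * The two implications *)

Theorem theorem5p4 (d : measure_display) (T : measurableType d) (R : realType)
    (P : probability T R) (n : nat) (n_gt0 : (0 < n)%N) :
  (forall G : set (L0V P n),
     G !=set0 -> as_bounded G -> closed G -> L0convex G ->
     forall f : L0V P n -> L0V P n,
       set_fun G G f -> sigma_stable_map G f -> {within G, continuous f} ->
       exists2 x, G x & f x = x)
  <->
  (forall U : T -> set 'rV[R]_n,
     measurable_graph U ->
     (forall t, [/\ U t !=set0, bounded_set (U t), closed (U t) &
        convex_set (U t : set (convex_lmodType 'rV[R]_n))]) ->
     forall h : L0V P n -> L0V P n,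
       set_fun (selections P U) (selections P U) h ->
       local_map (selections P U) h ->
       {within selections P U, continuous h} ->
       exists2 x, selections P U x & h x = x).
Proof.
split=> [fixA U mU Ucc h hU lh ch|fixB G nG bG cG convG f fG sf cf].
  have nU : selections P U !=set0.
    by apply: measurable_graph_selection mU _ => t; case: (Ucc t).
  apply: fixA => //.
  - by apply: as_bounded_selections nU _ => t; case: (Ucc t).
  - by apply: closed_selections => t; case: (Ucc t).
  - by apply: L0convex_selections => t; case: (Ucc t).
  - by apply: local_sigma_stable lh => A x; exact: selections_concat.
have concatG := L0convex_concat cG convG.
have [x Gx xdense] := ae_dense_sequence nG concatG.
(* Combinations with constant rational coefficients stay in [G], so density applies to them; there
   are countably many, hence one null set for all. *)
have aeconv : {ae P, forall t, forall ijq : nat * nat * rat, 0 <= ijq.2 <= 1 ->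
    limit_points (fun k => vfun (x k) t)
      (ratr ijq.2 *: vfun (x ijq.1.1) t +
       (1 - ratr ijq.2) *: vfun (x ijq.1.2) t)}.
  apply: ae_forall_countable => -[[i j] q] /=.
  have [q01|nq] := boolP (0 <= q <= 1); last exact: nearW.
  have cst c := ae_L0fun_class P (@measurable_cst _ _ T R setT c).
  pose l : L0R P := L0cst P (ratr q).
  have [l0 l1] : L0plus l /\ L0le l (L0cst P 1).
    split.
      apply: filterS2 (cst 0) (cst (ratr q)) => t; rewrite /l /L0cst => -> ->.
      by rewrite /= ler0q; case/andP: q01.
    apply: filterS2 (cst 1) (cst (ratr q)) => t; rewrite /l /L0cst => -> ->.
    by rewrite /= -(rmorph1 (@ratr R)) ler_rat; case/andP: q01.
  have Gc := convG _ _ _ (Gx i) (Gx j) l0 l1.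
  apply: filterS3 (xdense _ Gc) (vfun_conv l (x i) (x j)) (cst (ratr q)).
  by move=> t + cE lE _; rewrite cE /l /L0cst lE.
have aebd : {ae P, forall t, exists M, forall k, `|vfun (x k) t| <= M}.
  have [r _ [rub _]] := bG.
  have : {ae P, forall t, forall k, enorm (vfun (x k) t) <= L0fun r t}.
    apply: ae_foralln => k.
    have ub : ae_le P (L0barfun (L0R_bar (L0norm (x k)))) (L0barfun (L0R_bar r)).
      by apply: rub; exists (x k).
    apply: filterS3 (ae_L0bar_norm (x k)) (ae_L0barfun r) ub => t -> ->.
    by rewrite -lee_fin.
  apply: filterS => t xr; exists (L0fun r t) => k.
  exact: le_trans (norm_le_enorm _) (xr k).
(* Off [N] the closure of the values is bounded and convex; on [N] it is replaced by a singleton. *)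
have [N [mN PN NP]] := ae_measurable (filterI aeconv aebd).
pose U := random_closure N x.
have UG : selections P U = G by exact: selections_random_closure.
rewrite -UG in fG cf *.
apply: fixB => //.
- exact: measurable_graph_random_closure.
- move=> t; rewrite /U /random_closure; case: asboolP => [Nt|nNt].
    split.
    + by exists 0.
    + exists 0; split=> [|e e0 v ->]; first exact: num_real.
      by rewrite /= normr0 ltW.
    + apply: compact_closed; [exact: norm_hausdorff|exact: compact_set1].
    + apply/convex_set_segment => v w l _ -> ->.
      by rewrite !scaler0 addr0.
  have [convt [M xM]] := NP t nNt; split.
  + exists (vfun (x 0%N) t) => e e0; exists 0%N.
    by rewrite subrr normr0.
  + exact: bounded_limit_points xM.
  + exact: closed_limit_points.
  + apply: convex_limit_points xM _ => i j q q01.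
    exact: (convt (i, j, q)).
- by rewrite UG; exact: sigma_stable_local.
Qed.
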